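(* Let $H$ be a bipartite graph containing a matching of size $x$ and at most $\frac{1}{2}\sqrt{x-1}$ unmatched vertices (that is, $H$ has a matching consisting of $x$ edges such that at most $\frac{1}{2}\sqrt{x-1}$ vertices of $H$ are not covered by it). Then there exists $n_1 = n_1(H)$ such that for every integer $n \geq n_1$ there is a complete bipartite graph $B$ on $n$ vertices (not necessarily balanced) such that for every triangle-free graph $G$ on $n$ vertices, the number of copies of $H$ in $G$ is at most the number of copies of $H$ in $B$.
   Context: All graphs are finite and simple. The number of copies of $H$ in $G$ is the number of subgraphs of $G$ (not necessarily induced) isomorphic to $H$. Here $x \geq 1$ is an integer, so that the square root is defined. *)

(* Defs.v *)
From HB Require Import structures.
From mathcomp Require Import all_boot all_order all_algebra.

Set Implicit Arguments.
Unset Strict Implicit.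
Unset Printing Implicit Defensive.

Record sgraph := SGraph {
  vertex :> finType;
  adj : rel vertex;
  adj_sym : symmetric adj;
  adj_irr : irreflexive adj
}.

Definition edges (G : sgraph) : {set {set G}} :=
  [set [set p.1; p.2] | p : G * G & adj p.1 p.2].

Definition bipartite (G : sgraph) : Prop :=
  exists A : {set G}, forall u v : G, adj u v -> (u \in A) != (v \in A).

Definition complete_bipartite (G : sgraph) : Prop :=
  exists A : {set G},
    [/\ A != set0, ~: A != set0
      & forall u v : G, adj u v = ((u \in A) != (v \in A))].

Definition triangle_free (G : sgraph) : Prop :=
  forall u v w : G, ~ [/\ adj u v, adj v w & adj u w].

Definition matching (G : sgraph) (M : {set {set G}}) : Prop :=
  M \subset edges G /\ trivIset M.

(* A subgraph of G is a pair S = (W, F) of a vertex set and an edge set, so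
   that isolated vertices matter when subgraphs are counted. *)
Definition is_subgraph (G : sgraph) (S : {set G} * {set {set G}}) : bool :=
  (S.2 \subset edges G) && [forall e in S.2, e \subset S.1].

(* Meaningful for subgraphs S of G only: S.2 then contains nothing but pairs
   of vertices of S.1, so that f is an isomorphism from H onto S. *)
Definition iso_to (H G : sgraph) (S : {set G} * {set {set G}}) : bool :=
  [exists f : {ffun H -> G},
     [&& injectiveb f, f @: [set: H] == S.1
       & [forall u, forall v, adj u v == ([set f u; f v] \in S.2)]]].

Definition copies (H G : sgraph) : nat :=
  #|[set S : {set G} * {set {set G}} | is_subgraph S && iso_to H S]|.

(* Main.v *)
Require Import Defs.
From mathcomp Require Import all_boot all_order all_fingroup all_algebra.
From mathcomp Require Import zify ring lra.
Import Order.TTheory GRing.Theory Num.Theory.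

(**
Embeddings of H into a graph are the copies of H, each counted as often as H
has automorphisms, so it suffices to compare numbers of embeddings.  A bipartite
G lies in a complete bipartite graph on its n vertices, and B is chosen as the
best of these.  What has to be shown is that, for n large, a triangle-free G
that is not bipartite admits at most as many embeddings as the balanced complete
bipartite graph ([count_comparison] together with [embeddings_le_matchings] and
[embeddings_Kab_ge]).

Enlarge the given matching of H to a maximum one, with x edges; the u vertices
it misses are then independent, and 4 u^2 + 1 <= x still holds.  An embedding
is counted by first choosing the image of the matching, then the rest.

In G two adjacent vertices have disjoint neighbourhoods, and these do not cover
G, as otherwise G would be bipartite ([slack_gt0]).  So the degrees of adjacent
vertices add up to at most n - 1, and by Cauchy-Schwarz G has (1 - d) n^2 / 4
edges with d >= 1 / n ([gap_ge]).  The sum of all defects n - (degree u + degree v) is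
governed by d as well, so that putting an edge into a matching excludes on average
almost n edges; hence G has at most about (1 - d)^x times as many x-matchings as
the balanced complete bipartite graph ([ordered_matchings_step],
[matchings_recursion]).

Once the image of the matching is fixed, a vertex sees at most one end of each of
its edges.  Exploring H along its edges therefore determines how the edges are
placed, up to the choices that a proper 2-colouring of H leaves, and an unmatched
vertex ranges over the neighbourhood of a vertex already placed.  If one end of
an edge has many neighbours then the other has few, and averaging over both
placements gives at most (D^u + D'^u) / 2 extensions for each proper 2-colouring
of H, where D bounds the degrees and D + D' = n - 2 x ([list_hom_bound]).  An
independent neighbourhood of size Delta forces at most Delta (n - Delta) edges,
so D exceeds (n - 2 x) / 2 by a relative amount y, and y^2 <= 2 d for n large.  The
linear terms of (1 + y)^u + (1 - y)^u cancel, and the gain over two copies of 1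
is at most a factor (1 - d)^-(u (u - 1)) ([even_part_le]).

A balanced complete bipartite graph realises every proper 2-colouring of H and
loses, against ((n - 2 x) / 2)^u, no more than a factor (1 - 1/n)^(2 u^2 + 2 u)
([half_pow_ge]).  Since x - u (u - 1) > 2 u^2 + 2 u, at least one factor 1 - d,
hence 1 - 1/n, is left, and it pays for all errors of smaller order
([loss_beats_gain]).
*)

Set Implicit Arguments.
Unset Strict Implicit.
Unset Printing Implicit Defensive.

(** * Counting list homomorphisms *)

Definition proper_colourings (H : sgraph) : {set {ffun H -> bool}} :=
  [set chi : {ffun H -> bool} | [forall u, forall v, adj u v ==> (chi u != chi v)]].

Section ListHom.
(* The intended situation: a matching of H with vertex set [matched] has been
   mapped to a matching of G up to the order of the ends of each edge, and L v is
   the set of places still allowed for v: two for a matched vertex, all vertices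
   off the image for an unmatched one. *)
Variables (H G : sgraph) (L : H -> {set G}) (matched : {set H}) (g0 : G).
Variables (D D' : nat).

(** Vertices outside [S] take the junk value [g0], so that each partial map on
    [S] is counted exactly once. *)
Definition partial_homs (S : {set H}) : {set {ffun H -> G}} :=
  [set f : {ffun H -> G} | [&& [forall v in S, f v \in L v],
               [forall u in S, forall v in S, adj u v ==> adj (f u) (f v)]
             & [forall v in ~: S, f v == g0]]].

Lemma partial_homsP (S : {set H}) (f : {ffun H -> G}) :
  reflect [/\ {in S, forall v, f v \in L v},
              {in S &, forall u v, adj u v -> adj (f u) (f v)}
            & forall v, v \notin S -> f v = g0] (f \in partial_homs S).
Proof.
rewrite inE; apply: (iffP and3P) => -[h1 h2 h3]; split.
- by move=> v vS; apply: (forall_inP h1).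
- by move=> u v uS vS; move/forall_inP/(_ u uS)/forall_inP/(_ v vS)/implyP: h2.
- move=> v vS; apply/eqP; move/forall_inP: h3; apply; by rewrite inE.
- by apply/forall_inP.
- by apply/forall_inP => u uS; apply/forall_inP => v vS; apply/implyP; apply: h2.
- by apply/forall_inP => v; rewrite inE => vS; apply/eqP; apply: h3.
Qed.

Definition update (h : {ffun H -> G}) (t : H) (g : G) : {ffun H -> G} :=
  [ffun v => if v == t then g else h v].

Lemma partial_homs_erase (t : H) (S : {set H}) (f : {ffun H -> G}) : t \notin S ->
  f \in partial_homs (t |: S) -> update f t g0 \in partial_homs S.
Proof.
move=> tS /partial_homsP[h1 h2 h3].
have nt v : v \in S -> (v == t) = false.
  by move=> vS; apply/eqP => E; rewrite -E vS in tS.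
apply/partial_homsP; split.
- by move=> v vS; rewrite ffunE (nt v) // h1 // !inE vS orbT.
- by move=> u v uS vS uv; rewrite !ffunE !nt // h2 // !inE ?uS ?vS orbT.
- move=> v vS; rewrite ffunE; case: eqP => // /eqP vt.
  by apply: h3; rewrite !inE negb_or vt.
Qed.

Lemma update_erase (f : {ffun H -> G}) (t : H) : f = update (update f t g0) t (f t).
Proof. by apply/ffunP => v; rewrite !ffunE; case: eqP => // ->. Qed.

(** A map on [t |: S] is determined by its part on [S] and its value at [t]. *)
Lemma card_ext_le (t : H) (S : {set H}) (A : {set {ffun H -> G}}) :
  t \notin S -> A \subset partial_homs (t |: S) ->
  #|A| <= \sum_(h in partial_homs S) #|[set g | update h t g \in A]|.
Proof.
move=> tS AS.
rewrite -sum1_card (partition_big (fun f => update f t g0) (mem (partial_homs S))) /=;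
  last first.
  by move=> f fA; apply: partial_homs_erase => //; apply: (subsetP AS).
apply: leq_sum => h hS; rewrite sum1_card.
rewrite -(card_in_imset (f := fun f : {ffun H -> G} => f t)
   (D := [pred f | (f \in A) && (update f t g0 == h)])); last first.
  move=> f f' /andP[_ /eqP E] /andP[_ /eqP E'] ft.
  by rewrite (update_erase f t) (update_erase f' t) E E' ft.
apply: subset_leq_card; apply/subsetP => g /imsetP[f /andP[fA /eqP E] ->].
by rewrite inE -E -update_erase.
Qed.

Hypothesis matched_nbrs : forall v g, v \in matched -> #|[set g' in L v | adj g g']| <= 1.
Hypothesis matched_size : forall v, v \in matched -> #|L v| <= 2.
Hypothesis free_size : forall w, w \notin matched -> #|L w| <= D + D'.
Hypothesis free_nbrs : forall v w g, v \in matched -> w \notin matched -> g \in L v ->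
  #|[set g' in L w | adj g g']| <= D.
Hypothesis free_nbrs_pair : forall v w, v \in matched -> w \notin matched ->
  \sum_(g in L v) #|[set g' in L w | adj g g']| <= D + D'.
Hypothesis matched_cover : forall u v : H, adj u v -> (u \in matched) || (v \in matched).
Hypothesis D'D : D' <= D.
Hypothesis Hbip : bipartite H.

Definition num_unmatched (S : {set H}) := #|S :\: matched|.
Definition weight (v : H) := if v \in matched then 1 else D.
Definition restrict (S : {set H}) (chi : {ffun H -> bool}) : {ffun H -> bool} :=
  [ffun v => (v \in S) && chi v].
Definition homs_through (S : {set H}) v g := [set f in partial_homs S | f v == g].

(** [S] is explored in search order and [c] is the number of components entered.
    The first clause is the bound aimed at.  Of the two placements of a matched
    edge one may leave room [D] to its unmatched neighbours and the other only
    [D'], and the bound rests on not all maps using the favourable placement: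
    this is the second clause, which caps the maps with one prescribed value.
    Its weight is [D] at an unmatched vertex, because prescribing the value there
    saves one choice among [D].  In the third clause the colourings of the
    explored part are those that extend to [H]. *)
Definition step_invariant (S : {set H}) c :=
  [/\ 2 * #|partial_homs S| <= 2 ^ c * (D ^ num_unmatched S + D' ^ num_unmatched S),
      forall v g, v \in S -> 2 * weight v * #|homs_through S v g| <=
        2 ^ c * D ^ num_unmatched S
    & 2 ^ c <= #|[set restrict S chi | chi in proper_colourings H]|].

Lemma step_invariant0 : step_invariant set0 0.
Proof.
have u0 : num_unmatched set0 = 0 by rewrite /num_unmatched set0D cards0.
split.
- rewrite u0 !expn0 mul1n -[1 + 1]/(2 * 1) leq_mul2l /=.
  rewrite -(cards1 ([ffun => g0] : {ffun H -> G})).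
  apply: subset_leq_card; apply/subsetP => f /partial_homsP[_ _ h].
  by rewrite inE; apply/eqP/ffunP => v; rewrite ffunE h // inE.
- by move=> v g; rewrite inE.
- case: Hbip => A hA; rewrite expn0 card_gt0; apply/set0Pn.
  exists (restrict set0 [ffun v => v \in A]); apply: imset_f.
  rewrite inE; apply/forallP => u; apply/forallP => v; apply/implyP => /hA.
  by rewrite !ffunE.
Qed.

Lemma num_unmatched_matched (t : H) (S : {set H}) : t \in matched ->
  num_unmatched (t |: S) = num_unmatched S.
Proof.
move=> tm; congr #|pred_of_set _|; apply/setP => v; rewrite !inE.
by case: (altP (v =P t)) => // ->; rewrite tm.
Qed.

Lemma num_unmatched_unmatched (t : H) (S : {set H}) : t \notin matched -> t \notin S ->
  num_unmatched (t |: S) = (num_unmatched S).+1.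
Proof.
move=> tm tS; rewrite /num_unmatched.
have -> : (t |: S) :\: matched = t |: (S :\: matched).
  by apply/setP => v; rewrite !inE; case: (altP (v =P t)) => // ->; rewrite tm.
by rewrite cardsU1 !inE (negbTE tS) andbF.
Qed.

Definition extensions (S : {set H}) (h : {ffun H -> G}) t :=
  [set g | update h t g \in partial_homs (t |: S)].

Lemma extensions_list (S : {set H}) h t g : g \in extensions S h t -> g \in L t.
Proof.
rewrite inE => /partial_homsP[/(_ t) h1 _ _]; move: h1.
by rewrite ffunE eqxx; apply; rewrite !inE eqxx.
Qed.

Lemma extensions_adj (S : {set H}) h (s t : H) g : t \notin S -> s \in S -> adj s t ->
  g \in extensions S h t ->
  adj (h s) g.
Proof.
move=> tS sS st; rewrite inE => /partial_homsP[_ /(_ s t) h1 _]; move: h1.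
rewrite !ffunE eqxx; case: eqP => [E|_]; first by rewrite -E sS in tS.
by apply=> //; rewrite !inE ?sS ?eqxx ?orbT.
Qed.

Lemma homs_through_extend (S : {set H}) (t v : H) (g : G) k : t \notin S -> v \in S ->
  (forall h, h \in partial_homs S -> #|extensions S h t| <= k) ->
  #|homs_through (t |: S) v g| <= k * #|homs_through S v g|.
Proof.
move=> tS vS hk.
have vt : (v == t) = false by apply/eqP => E; rewrite -E vS in tS.
have sub : homs_through (t |: S) v g \subset partial_homs (t |: S).
  by apply/subsetP => f; rewrite inE => /andP[].
apply: leq_trans (card_ext_le tS sub) _.
rewrite mulnC -sum_nat_const.
rewrite [X in _ <= X](eq_bigl (fun h => (h \in partial_homs S) && (h v == g))); last first.
  by move=> h; rewrite inE.
rewrite [X in _ <= X]big_mkcondr /=; apply: leq_sum => h hS; case: ifP => hv.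
  apply: leq_trans (hk h hS); apply: subset_leq_card.
  by apply/subsetP => g'; rewrite !inE => /andP[].
rewrite leqn0 cards_eq0; apply/eqP/setP => g'; rewrite !inE !ffunE vt hv.
by rewrite andbF.
Qed.

Lemma partial_homs_extend (S : {set H}) (t : H) k : t \notin S ->
  (forall h, h \in partial_homs S -> #|extensions S h t| <= k) ->
  #|partial_homs (t |: S)| <= k * #|partial_homs S|.
Proof.
move=> tS hk; apply: leq_trans (card_ext_le tS (subxx _)) _.
by rewrite mulnC -sum_nat_const; apply: leq_sum => h; apply: hk.
Qed.

(** The value at the neighbour [s] must be adjacent to the value at [t]. *)
Lemma homs_through_new (S : {set H}) (t s : H) (g : G) : t \notin S -> s \in S -> adj s t ->
  #|homs_through (t |: S) t g| <= \sum_(g' in [set g' in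
    L s | adj g g']) #|homs_through S s g'|.
Proof.
move=> tS sS st.
have sub : homs_through (t |: S) t g \subset partial_homs (t |: S).
  by apply/subsetP => f; rewrite inE => /andP[].
apply: leq_trans (card_ext_le tS sub) _.
have -> : \sum_(g' in [set g' in L s | adj g g']) #|homs_through S s g'| =
   #|[set h in partial_homs S | adj g (h s)]|.
  rewrite -sum1_card (partition_big (fun h : {ffun H -> G} => h s)
     (mem [set g' in L s | adj g g'])) /=; last first.
    move=> h; rewrite !inE => /andP[hS ->]; rewrite andbT.
    by have /partial_homsP[h1 _ _] : h \in partial_homs S; [rewrite inE | apply: h1].
  apply: eq_bigr => g' /[!inE] /andP[_ ag]; rewrite -sum1_card; apply: eq_bigl => h.
  rewrite !inE -!andbA; do 3!congr (_ && _).
  by case: eqP => [->|]; rewrite ?ag // andbF.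
rewrite -sum1_card [X in _ <= X](eq_bigl (fun h =>
  (h \in partial_homs S) && adj g (h s))); last first.
  by move=> h; rewrite inE.
rewrite [X in _ <= X]big_mkcondr /=; apply: leq_sum => h hS.
have key g' : g' \in [set g' | update h t g' \in homs_through (t |: S) t g] ->
  g' = g /\ adj g (h s).
  rewrite 2!inE => /andP[h1 /eqP]; rewrite ffunE eqxx => <-; split=> //.
  by rewrite adj_sym; apply: (extensions_adj tS sS st); rewrite inE.
case: ifP => ag.
  rewrite -(cards1 g); apply: subset_leq_card; apply/subsetP => g' /key[-> _].
  by rewrite inE.
by rewrite leqn0 cards_eq0; apply/eqP/setP => g'; rewrite [RHS]inE;
  apply/negP => /key[_]; rewrite ag.
Qed.

Lemma homs_through_free (S : {set H}) (t : H) (g : G) : t \notin S ->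
  #|homs_through (t |: S) t g| <= #|partial_homs S|.
Proof.
move=> tS.
have sub : homs_through (t |: S) t g \subset partial_homs (t |: S).
  by apply/subsetP => f; rewrite inE => /andP[].
apply: leq_trans (card_ext_le tS sub) _; rewrite -sum1_card.
apply: leq_sum => h hS; rewrite -(cards1 g); apply: subset_leq_card.
by apply/subsetP => g'; rewrite !inE ffunE eqxx => /andP[].
Qed.

Lemma restrict_mono (S T : {set H}) c : S \subset T ->
  2 ^ c <= #|[set restrict S chi | chi in proper_colourings H]| ->
  2 ^ c <= #|[set restrict T chi | chi in proper_colourings H]|.
Proof.
move=> ST /leq_trans; apply.
have -> : [set restrict S chi | chi in proper_colourings H] =
   [set restrict S chi | chi in [set restrict T chi | chi in proper_colourings H]].
  rewrite -imset_comp; apply: eq_imset => chi; apply/ffunP => v; rewrite !ffunE.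
  by case: (boolP (v \in S)) => //= vS; rewrite (subsetP ST).
exact: leq_imset_card.
Qed.

(** No edge leaves [S], so a colouring may be flipped outside [S]; hence each
    colouring of [S] extends with both colours at [t]. *)
Lemma restrict_root (S : {set H}) t c : t \notin S ->
  (forall s v, s \in S -> v \notin S -> ~~ adj s v) ->
  2 ^ c <= #|[set restrict S chi | chi in proper_colourings H]| ->
  2 ^ c.+1 <= #|[set restrict (t |: S) chi | chi in proper_colourings H]|.
Proof.
move=> tS cl le.
set RS := [set _ | chi in _] in le; set RT := [set _ | chi in _].
pose F b (r : {ffun H -> bool}) := [ffun v => if v == t then b else r v].
have FE b r v : F b r v = if v == t then b else r v by rewrite ffunE.
have sub b : F b @: RS \subset RT.
  apply/subsetP => _ /imsetP[_ /imsetP[chi chiC ->] ->].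
  apply/imsetP; exists [ffun v => if v \in S then chi v else chi v (+) chi t (+) b].
    move: chiC; rewrite !inE => /forallP hc; apply/forallP => u; apply/forallP => v.
    have {hc}:= forallP (hc u) v; case: (boolP (adj u v)) => //= uv.
    rewrite !ffunE; case: (boolP (u \in S)) => uS; case: (boolP (v \in S)) => vS //.
    - by move: (cl u v uS vS); rewrite uv.
    - by move: (cl v u vS uS); rewrite adj_sym uv.
    by case: (chi u); case: (chi v); case: (chi t); case: (b).
  apply/ffunP => v; rewrite !ffunE !inE; case: (altP (v =P t)) => [->|vt] /=.
    by rewrite (negbTE tS); case: (chi t); case: (b).
  by case: (v \in S).
have rst r : r \in RS -> r t = false by case/imsetP => chi _ ->; rewrite ffunE (negbTE tS).
have cF b : #|F b @: RS| = #|RS|.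
  apply: card_in_imset => r r' rS rS' E; apply/ffunP => v.
  by move/ffunP/(_ v): E; rewrite !FE; case: eqP => // -> _; rewrite !rst.
have dF : F true @: RS :&: F false @: RS = set0.
  apply/setP => r; rewrite !inE; apply/negP.
  by case/andP => /imsetP[r1 _ ->] /imsetP[r2 _ /ffunP/(_ t)]; rewrite !FE eqxx.
have sU : F true @: RS :|: F false @: RS \subset RT by rewrite subUset !sub.
apply: leq_trans (subset_leq_card sU).
by rewrite cardsU dF cards0 subn0 !cF expnS mul2n -addnn leq_add.
Qed.

(** [P0] and [P1] count the maps with either placement of a matched edge, [al]
    and [be] the room that each leaves to a new neighbour.  By linearity the
    extreme case gives all of [D] to the more frequent placement. *)
Lemma two_point_le w k P0 P1 al be :
  2 * (P0 + P1) <= k * (D ^ w + D' ^ w) -> 2 * P0 <= k * D ^ w -> 2 * P1 <= k * D ^ w ->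
  al <= D -> be <= D -> al + be <= D + D' ->
  2 * (P0 * al + P1 * be) <= k * (D ^ w.+1 + D' ^ w.+1).
Proof.
wlog le10 : P0 P1 al be / P1 <= P0.
  move=> W h0 h1 h2 h3 h4 h5; case: (leqP P1 P0) => le; first exact: W.
  by rewrite addnC; apply: W; rewrite 1?addnC // ltnW.
move=> h0 h1 _ h3 _ h5; rewrite !expnS.
set A := D ^ w in h0 h1 *; set B := D' ^ w in h0 *.
have e1 : P0 * al + P1 * be = (P0 - P1) * al + P1 * (al + be) by nia.
have e2 : (P0 - P1) * al + P1 * (al + be) <= (P0 - P1) * D + P1 * (D + D').
  by rewrite leq_add // leq_mul2l ?h3 ?h5 orbT.
have e3 : (P0 - P1) * D + P1 * (D + D') = P0 * (D - D') + (P0 + P1) * D' by nia.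
have e4 : 2 * P0 * (D - D') <= k * A * (D - D') by rewrite leq_mul2r h1 orbT.
have e5 : 2 * (P0 + P1) * D' <= k * (A + B) * D' by rewrite leq_mul2r h0 orbT.
rewrite e1; nia.
Qed.

Lemma homs_through_outside (S : {set H}) v g : v \in S -> g \notin L v ->
  #|homs_through S v g| = 0.
Proof.
move=> vS gL; apply/eqP; rewrite cards_eq0; apply/eqP/setP => f; rewrite [RHS]inE.
apply/negP; rewrite inE => /andP[/partial_homsP[h1 _ _] /eqP E].
by move: gL; rewrite -E h1.
Qed.

(** A vertex of [G] is adjacent to at most one element of the list of [t], so
    the neighbour [s] leaves no choice for [t]. *)
Lemma step_matched (S : {set H}) c (s t : H) : step_invariant S c -> t \notin S ->
  s \in S -> adj s t -> t \in matched ->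
  step_invariant (t |: S) c.
Proof.
case=> I1 I2 I3 tS sS st tm.
have ext1 h : h \in partial_homs S -> #|extensions S h t| <= 1.
  move=> hS; apply: leq_trans (matched_nbrs (h s) tm); apply: subset_leq_card.
  apply/subsetP => g gE; rewrite inE (extensions_list gE) /=.
  exact: (extensions_adj tS sS st gE).
split.
- rewrite num_unmatched_matched //; apply: leq_trans I1; rewrite leq_mul2l /=.
  by rewrite -[#|partial_homs S|]mul1n; apply: partial_homs_extend.
- move=> v g; rewrite num_unmatched_matched // !inE => /orP[/eqP ->|vS].
    case: (boolP (g \in L t)) => gL;
      last by rewrite homs_through_outside ?muln0 // !inE eqxx.
    have := homs_through_new g tS sS st; rewrite /weight tm muln1.
    move/(fun le => leq_trans (leq_mul (leqnn 2) le)); apply.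
    case: (boolP (s \in matched)) => sm.
      rewrite big_distrr /=.
      apply: (@leq_trans (\sum_(g' in [set g' in
        L s | adj g g']) 2 ^ c * D ^ num_unmatched S)).
        by apply: leq_sum => g' _; have := I2 s g' sS; rewrite /weight sm muln1.
      by rewrite sum_nat_const -[X in _ <= X]mul1n leq_mul2r matched_nbrs ?orbT.
    have [D0|D0] := posnP D.
      have := free_nbrs tm sm gL; rewrite D0 leqn0 cards_eq0 => /eqP ->.
      by rewrite big_set0 muln0.
    suff : D * (2 * \sum_(g' in [set g' in L s | adj g g']) #|homs_through S s g'|) <=
           D * (2 ^ c * D ^ num_unmatched S) by rewrite leq_pmul2l.
    rewrite mulnA (mulnC D) big_distrr /=.
    apply: (@leq_trans (\sum_(g' in [set g' in
      L s | adj g g']) 2 ^ c * D ^ num_unmatched S)).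
      by apply: leq_sum => g' _; have := I2 s g' sS; rewrite /weight (negbTE sm).
    by rewrite sum_nat_const leq_mul2r (free_nbrs tm sm gL) orbT.
  apply: leq_trans (I2 v g vS); rewrite leq_mul2l; apply/orP; right.
  by rewrite -[#|homs_through S v g|]mul1n; apply: homs_through_extend.
- by apply: restrict_mono I3; apply: subsetUr.
Qed.

Lemma sum_homs_through (S : {set H}) (s : H) (F : G -> nat) : s \in S ->
  \sum_(h in partial_homs S) F (h s) = \sum_(g in L s) #|homs_through S s g| * F g.
Proof.
move=> sS; rewrite (partition_big (fun h : {ffun H ->
  G} => h s) (fun g => g \in L s)) /=; last first.
  by move=> h /partial_homsP[h1 _ _]; apply: h1.
apply: eq_bigr => g _; rewrite -sum_nat_const.
rewrite [RHS](eq_bigl (fun h => (h \in partial_homs S) && (h s == g))) => [|h].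
  by apply: eq_bigr => h /andP[_ /eqP ->].
by rewrite inE.
Qed.

(** The step that averages over the two placements of the edge of [s]; the
    crude bound of [D] choices would lose the cancellation. *)
Lemma step_unmatched (S : {set H}) c (s t : H) : step_invariant S c -> t \notin S ->
  s \in S -> adj s t -> t \notin matched ->
  step_invariant (t |: S) c.
Proof.
case=> I1 I2 I3 tS sS st tm.
have sm : s \in matched by have := matched_cover st; rewrite (negbTE tm) orbF.
pose dg g := #|[set g' in L t | adj g g']|.
have ext1 h : h \in partial_homs S -> #|extensions S h t| <= dg (h s).
  move=> hS; apply: subset_leq_card.
  apply/subsetP => g gE; rewrite inE (extensions_list gE) /=.
  exact: (extensions_adj tS sS st gE).
have extD h : h \in partial_homs S -> #|extensions S h t| <= D.
  by move=> hS; apply: leq_trans (ext1 h hS) _; apply: free_nbrs sm _ _ => //;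
    case/partial_homsP: hS => h1 _ _; apply: h1.
split.
- rewrite num_unmatched_unmatched //.
  have le1 : #|partial_homs (t |: S)| <= \sum_(g in L s) #|homs_through S s g| * dg g.
    rewrite -sum_homs_through //; apply: leq_trans (card_ext_le tS (subxx _)) _.
    by apply: leq_sum => h; apply: ext1.
  have N1 : #|partial_homs S| = \sum_(g in L s) #|homs_through S s g|.
    rewrite -sum1_card (sum_homs_through (fun=> 1) sS).
    by apply: eq_bigr => g _; rewrite muln1.
  have I2s g : 2 * #|homs_through S s g| <= 2 ^ c * D ^ num_unmatched S.
    by have := I2 s g sS; rewrite /weight sm muln1.
  have u2 g : g \in L s -> dg g <= D by apply: free_nbrs.
  have u3 : \sum_(g in L s) dg g <= D + D' by apply: free_nbrs_pair.
  apply: leq_trans (leq_mul (leqnn 2) le1) _.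
  have := matched_size sm; rewrite leq_eqVlt => /orP[/cards2P[p [q [pq E]]]|].
    move: le1 N1 u2 u3; rewrite E !big_setU1 ?inE //= !big_set1 => le1 N1 u2 u3.
    apply: two_point_le => //; first by rewrite -N1.
      by apply: u2; rewrite !inE eqxx.
    by apply: u2; rewrite !inE eqxx orbT.
  rewrite ltnS leq_eqVlt => /orP[/cards1P[p E]|].
    move: le1 N1 u2 u3; rewrite E !big_set1 => le1 N1 u2 u3.
    rewrite -[_ * dg p]addn0 -(muln0 0); apply: two_point_le => //.
    - by rewrite addn0 -N1.
    - by apply: u2; rewrite !inE eqxx.
    by rewrite addn0.
  by rewrite ltnS leqn0 cards_eq0 => /eqP ->; rewrite big_set0 muln0.
- move=> v g; rewrite num_unmatched_unmatched // !inE => /orP[/eqP ->|vS].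
    have := homs_through_new g tS sS st; rewrite /weight (negbTE tm).
    move/(fun le => leq_trans (leq_mul (leqnn (2 * D)) le)); apply.
    rewrite expnS mulnCA (mulnC 2) -mulnA leq_mul2l big_distrr /=; apply/orP; right.
    apply: (@leq_trans (\sum_(g' in [set g' in
      L s | adj g g']) 2 ^ c * D ^ num_unmatched S)).
      by apply: leq_sum => g' _; have := I2 s g' sS; rewrite /weight sm muln1.
    by rewrite sum_nat_const -[X in _ <= X]mul1n leq_mul2r matched_nbrs ?orbT.
  rewrite expnS mulnCA.
  apply: leq_trans (leq_mul (leqnn D) (I2 v g vS)); rewrite mulnCA leq_mul2l.
  by apply/orP; right; apply: homs_through_extend.
- by apply: restrict_mono I3; apply: subsetUr.
Qed.

(** The doubling of the number of colourings pays for the two placements of a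
    matched edge, and for the [D + D'] places of an isolated vertex by
    Chebyshev's sum inequality. *)
Lemma step_root (S : {set H}) c (t : H) : step_invariant S c -> t \notin S ->
  (forall s v, s \in S -> v \notin S -> ~~ adj s v) -> step_invariant (t |: S) c.+1.
Proof.
case=> I1 I2 I3 tS cl.
have DD' : D' ^ num_unmatched S <=
  D ^ num_unmatched S by case: (num_unmatched S) => // k; rewrite leq_exp2r.
have extL h : #|extensions S h t| <= #|L t|.
  by apply: subset_leq_card; apply/subsetP => g; apply: extensions_list.
have NT : #|partial_homs (t |: S)| <=
  #|L t| * #|partial_homs S| by apply: partial_homs_extend.
have NA v g : v \in S -> #|homs_through (t |: S) v g| <= #|L t| * #|homs_through S v g|.
  by move=> vS; apply: homs_through_extend.
have NR g := homs_through_free g tS.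
have I1' : #|partial_homs S| <= 2 ^ c * D ^ num_unmatched S.
  rewrite -(leq_pmul2l (isT : 0 < 2)); apply: leq_trans I1 _.
  by rewrite mulnCA leq_mul2l mul2n -addnn leq_add2l DD' orbT.
split; last exact: restrict_root.
- case: (boolP (t \in matched)) => tm.
    rewrite num_unmatched_matched // expnS -mulnA leq_mul2l /=; apply: leq_trans NT _.
    by apply: leq_trans I1; rewrite leq_mul2r matched_size ?orbT.
  rewrite num_unmatched_unmatched // !expnS -mulnA leq_mul2l /=.
  apply: leq_trans NT _.
  have le2 := free_size tm.
  have le3 : #|L t| * #|partial_homs S| * 2 <=
    (D + D') * (2 ^ c * (D ^ num_unmatched S + D' ^ num_unmatched S)).
    by rewrite -mulnA (mulnC _ 2) leq_mul.
  rewrite -(leq_pmul2r (isT : 0 < 2)); apply: leq_trans le3 _.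
  set A := D ^ num_unmatched S in DD' *; set B := D' ^ num_unmatched S in DD' *.
  rewrite mulnCA -mulnA leq_mul2l; apply/orP; right.
  have : (D - D') * (A - B) + (D + D') * (A + B) = 2 * (D * A + D' * B) by nia.
  by lia.
- move=> v g; rewrite !inE => /orP[/eqP ->|vS]; rewrite /weight.
    case: (boolP (t \in matched)) => tm.
      rewrite num_unmatched_matched // muln1 expnS -mulnA leq_mul2l /=.
      exact: leq_trans (NR g) I1'.
    rewrite num_unmatched_unmatched // !expnS -!mulnA leq_mul2l /= mulnCA leq_mul2l.
    by rewrite (leq_trans (NR g) I1') orbT.
  apply: leq_trans (leq_mul (leqnn _) (NA v g vS)) _; rewrite mulnCA.
  case: (boolP (t \in matched)) => tm.
    rewrite num_unmatched_matched // expnS -[2 * 2 ^ c * _]mulnA; apply: leq_mul;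
      first exact: matched_size.
    exact: I2.
  rewrite num_unmatched_unmatched // !expnS.
  have -> : 2 * 2 ^ c * (D * D ^ num_unmatched S) =
    2 * D * (2 ^ c * D ^ num_unmatched S) by lia.
  apply: leq_mul; last exact: I2.
  by apply: leq_trans (free_size tm) _; lia.
Qed.

(** A vertex without explored neighbour is added only when nothing else is left,
    which makes [S] a union of components as [step_root] requires. *)
Lemma step_invariantT : exists c, step_invariant setT c.
Proof.
suff W k : forall (S : {set H}) c, step_invariant S c -> #|~: S| <= k ->
  exists c, step_invariant setT c.
  by apply: (W #|H| set0 0 step_invariant0); rewrite max_card.
elim: k => [|k IHk] S c IS.
  rewrite leqn0 cards_eq0 => /eqP E; exists c.
  by rewrite -[setT]setC0 -E setCK.
move=> le.
have next t c' : t \notin S -> step_invariant (t |: S) c' ->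
  exists c, step_invariant setT c.
  move=> tS /IHk; apply; rewrite -ltnS; apply: leq_trans le.
  rewrite setCU setIC -setDE; have := cardsD1 t (~: S); rewrite inE tS => ->.
  by rewrite add1n.
case: (boolP [exists t, (t \notin S) && [exists s in S, adj s t]]).
  case/existsP => t /andP[tS /exists_inP[s sS st]].
  case: (boolP (t \in matched)) => tm.
    exact: (next t c tS (step_matched IS tS sS st tm)).
  exact: (next t c tS (step_unmatched IS tS sS st tm)).
move=> /existsPn nx.
case: (set_0Vmem (~: S)) => [E|[t]].
  by exists c; rewrite -[setT]setC0 -E setCK.
rewrite inE => tS; apply: (next t c.+1 tS); apply: step_root => // s v sS vS.
by have := nx v; rewrite vS /= => /exists_inPn/(_ s sS).
Qed.

(** Nothing is lost in the number of colourings: under the embeddings into a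
    large complete bipartite graph every proper colouring of [H] occurs. *)
Lemma list_hom_bound :
  2 * #|[set f : {ffun H -> G} | [forall v, f v \in L v] &&
          [forall u, forall v, adj u v ==> adj (f u) (f v)]]| <=
  #|proper_colourings H| * (D ^ #|~: matched| + D' ^ #|~: matched|).
Proof.
have [c [I1 _ I3]] := step_invariantT.
have E : num_unmatched setT = #|~: matched| by rewrite /num_unmatched setTD.
rewrite E in I1.
have sub : [set f : {ffun H -> G} | [forall v, f v \in L v] &&
          [forall u, forall v, adj u v ==> adj (f u) (f v)]] \subset partial_homs setT.
  apply/subsetP => f; rewrite inE => /andP[/forallP h1 /forallP h2].
  apply/partial_homsP; split=> [v _|u v _ _|v]; [exact: h1| |by rewrite inE].
  by move/forallP/(_ v)/implyP: (h2 u).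
apply: leq_trans (leq_mul (leqnn 2) (subset_leq_card sub)) _.
apply: leq_trans I1 _; rewrite leq_mul2r; apply/orP; right.
by apply: leq_trans I3 _; apply: leq_imset_card.
Qed.

End ListHom.

(** * Copies and embeddings *)

Definition embeddings (H G : sgraph) : {set {ffun H -> G}} :=
  [set f : {ffun H -> G} | injectiveb f &&
     [forall u, forall v, adj u v ==> adj (f u) (f v)]].

Lemma embeddingsP (H G : sgraph) (f : {ffun H -> G}) :
  reflect (injective f /\ forall u v, adj u v -> adj (f u) (f v))
          (f \in embeddings H G).
Proof.
rewrite inE; apply: (iffP andP) => -[/injectiveP h1 h2]; split=> //.
  by move=> u v; move/forallP/(_ u)/forallP/(_ v)/implyP: h2.
by apply/forallP => u; apply/forallP => v; apply/implyP; apply: h2.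
Qed.

Definition image_subgraph (H G : sgraph) (f : {ffun H -> G}) :
    {set G} * {set {set G}} :=
  (f @: [set: H], [set [set f p.1; f p.2] | p : H * H & adj p.1 p.2]).

Lemma set2_inj (T : finType) (a b c d : T) :
  [set a; b] = [set c; d] -> (a = c /\ b = d) \/ (a = d /\ b = c).
Proof.
move=> E.
have ha : a \in [set c; d] by rewrite -E set21.
have hb : b \in [set c; d] by rewrite -E set22.
have hc : c \in [set a; b] by rewrite E set21.
have hd : d \in [set a; b] by rewrite E set22.
move: ha hb hc hd; rewrite !inE.
case/orP => /eqP -> /orP[] /eqP -> /orP[] /eqP hc /orP[] /eqP hd; by auto.
Qed.

Lemma mem_image_subgraph (H G : sgraph) (f : {ffun H -> G}) u v :
  injective f ->
  ([set f u; f v] \in (image_subgraph f).2) = adj u v.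
Proof.
move=> fI; apply/imsetP/idP => [[[a b]] /= | uv]; last by exists (u, v); rewrite ?inE.
rewrite inE /= => ab /set2_inj[[/fI -> /fI ->]|[/fI -> /fI ->]] //.
by rewrite adj_sym.
Qed.

Lemma copies_imset (H G : sgraph) :
  [set S : {set G} * {set {set G}} | is_subgraph S && iso_to H S] =
  [set image_subgraph f | f in embeddings H G].
Proof.
apply/setP => -[W F]; rewrite inE; apply/andP/imsetP => [[]|[f /embeddingsP[fI fH] ->]].
  case/andP => /= /subsetP FE /forall_inP FW /existsP[f /and3P[/injectiveP fI /eqP /= fW fF]].
  have fA u v : adj u v = ([set f u; f v] \in F).
    by move/forallP/(_ u)/forallP/(_ v)/eqP: fF.
  exists f.
    apply/embeddingsP; split=> // u v; rewrite fA => /FE /imsetP[[a b]] /[!inE] /= ab.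
    by case/set2_inj => -[-> ->] //; rewrite adj_sym.
  congr pair; first by rewrite -fW.
  apply/setP => e; apply/idP/imsetP => [eF|[[a b] /[!inE] /= ab ->]]; last by rewrite -fA.
  have /imsetP[[a b] _ E] := FE e eF; rewrite /= in E.
  have eW : e \subset f @: setT by rewrite fW FW.
  have /imsetP[u _ Eu] : a \in f @: setT by rewrite (subsetP eW) // E !inE eqxx.
  have /imsetP[v _ Ev] : b \in f @: setT by rewrite (subsetP eW) // E !inE eqxx orbT.
  by exists (u, v); rewrite /= ?inE /= ?fA -?Eu -?Ev -?E.
have key u v := mem_image_subgraph u v fI.
split.
  apply/andP; split.
    apply/subsetP => e /imsetP[[a b] /[!inE] /= ab ->].
    by apply/imsetP; exists (f a, f b); rewrite ?inE //=; apply: fH.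
  apply/forall_inP => e /imsetP[[a b] _ ->]; apply/subsetP => z.
  by rewrite !inE => /orP[] /eqP -> /=; apply: imset_f.
apply/existsP; exists f; apply/and3P; split=> //; first exact/injectiveP.
by apply/forallP => u; apply/forallP => v; rewrite key.
Qed.

(** Two embeddings with the same image differ by an automorphism of [H]. *)
Lemma image_eq_fibre (H G : sgraph) (f : {ffun H -> G}) : f \in embeddings H G ->
  #|[set g in embeddings H G | image_subgraph g == image_subgraph f]| =
  #|[set s : {perm H} | [forall u, forall v, adj (s u) (s v) == adj u v]]|.
Proof.
move=> /embeddingsP[fI fH].
pose F (s : {perm H}) := [ffun v => f (s v)].
rewrite -(card_imset (f := F)); last first.
  by move=> s s' /ffunP E; apply/permP => v; have := E v; rewrite !ffunE => /fI.
congr #|pred_of_set _|; apply/setP => g; rewrite inE; apply/andP/imsetP.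
  case=> /embeddingsP[gI gH] /eqP E.
  have gf v : exists u, f u == g v.
    have : g v \in (image_subgraph f).1 by rewrite -E; apply: imset_f.
    by case/imsetP => u _ ->; exists u.
  pose s0 v := xchoose (gf v).
  have fs v : f (s0 v) = g v by apply/eqP; apply: (xchooseP (gf v)).
  have s0I : injective s0 by move=> u v Euv; apply: gI; rewrite -!fs Euv.
  exists (perm s0I); last by apply/ffunP => v; rewrite ffunE permE fs.
  rewrite inE; apply/forallP => u; apply/forallP => v; rewrite !permE.
  by rewrite -(mem_image_subgraph _ _ fI) !fs -E mem_image_subgraph.
case=> s; rewrite inE => /forallP sA ->.
have sA' u v : adj (s u) (s v) = adj u v by apply/eqP; move/forallP: (sA u).
split.
  apply/embeddingsP; split=> [u v|u v uv]; rewrite !ffunE.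
    by move/fI/perm_inj.
  by rewrite fH // sA'.
apply/eqP; congr pair.
  apply/setP => z; apply/imsetP/imsetP => -[v _ ->].
    by exists (s v); rewrite ?ffunE.
  by exists (s^-1%g v); rewrite ?ffunE ?permKV.
apply/setP => z; apply/imsetP/imsetP => -[[a b]]; rewrite inE /= => ab ->.
  by exists (s a, s b); rewrite ?inE /= ?sA' ?ffunE.
exists (s^-1%g a, s^-1%g b); rewrite ?inE /= ?ffunE ?permKV //.
by rewrite -sA' !permKV.
Qed.

Lemma card_embeddings (H G : sgraph) :
  #|embeddings H G| = copies H G *
  #|[set s : {perm H} | [forall u, forall v, adj (s u) (s v) == adj u v]]|.
Proof.
rewrite /copies copies_imset.
rewrite -sum1_card (partition_big_imset (@image_subgraph H G)) /= -sum_nat_const.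
apply: eq_bigr => S /imsetP[f fE ->]; rewrite -(image_eq_fibre fE) sum1_card.
by apply: eq_card => g; rewrite [RHS]inE.
Qed.

Lemma copies_le (H G B : sgraph) :
  #|embeddings H G| <= #|embeddings H B| -> copies H G <= copies H B.
Proof.
rewrite !card_embeddings leq_pmul2r // card_gt0; apply/set0Pn; exists 1%g.
by rewrite inE; apply/forallP => u; apply/forallP => v; rewrite !perm1.
Qed.

Section CompleteBipartite.
Variables a b : nat.
Definition left_side (v : 'I_a + 'I_b) : bool := if v is inl _ then true else false.
Definition Kab_adj : rel ('I_a + 'I_b) := fun u v => left_side u != left_side v.
Lemma Kab_adj_sym : symmetric Kab_adj. Proof. by move=> u v; rewrite /Kab_adj eq_sym. Qed.
Lemma Kab_adj_irr : irreflexive Kab_adj. Proof. by move=> u; rewrite /Kab_adj eqxx. Qed.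
Definition Kab := SGraph Kab_adj_sym Kab_adj_irr.

Lemma card_Kab : #|Kab| = a + b.
Proof. by rewrite card_sum !card_ord. Qed.

Lemma Kab_complete : 0 < a -> 0 < b -> complete_bipartite Kab.
Proof.
move=> a0 b0; exists [set v : Kab | left_side v]; split.
- by apply/set0Pn; exists (inl (Ordinal a0)); rewrite inE.
- by apply/set0Pn; exists (inr (Ordinal b0)); rewrite !inE.
- by move=> u v; rewrite !inE.
Qed.
End CompleteBipartite.

Lemma embeddings_bipartite (H G : sgraph) (A : {set G}) :
  (forall u v : G, adj u v -> (u \in A) != (v \in A)) ->
  #|embeddings H G| <= #|embeddings H (Kab #|A| #|~: A|)|.
Proof.
move=> hA.
have [phi [phiI phiA]] : exists phi : G -> 'I_#|A| + 'I_#|~: A|,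
    injective phi /\ forall v, left_side (phi v) = (v \in A).
  pose phi (v : G) : 'I_#|A| + 'I_#|~: A| :=
    match boolP (v \in A) with
    | AltTrue h => inl (enum_rank_in h v)
    | AltFalse h => inr (enum_rank_in (introT setCP (negP h)) v)
    end.
  exists phi; split.
    move=> u v; rewrite /phi; case: {-}_ / boolP => hu; case: {-}_ / boolP => hv //=.
      by case; apply: enum_rank_in_inj.
    by case; apply: enum_rank_in_inj; rewrite inE.
  by move=> v; rewrite /phi; case: {-}_ / boolP => hv /=; rewrite ?hv ?(negbTE hv).
pose F (f : {ffun H -> G}) : {ffun H -> Kab #|A| #|~: A|} := [ffun v => phi (f v)].
rewrite -(card_imset (f := F)); last first.
  by move=> f g /ffunP E; apply/ffunP => v; have := E v; rewrite !ffunE => /phiI.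
apply: subset_leq_card; apply/subsetP => _ /imsetP[f /embeddingsP[fI fH] ->].
apply/embeddingsP; split=> [u v|u v uv]; rewrite !ffunE.
  by move/phiI/fI.
by rewrite /adj /= /Kab_adj !phiA; apply/hA/fH.
Qed.

Lemma ffact_ge (n m k u : nat) : m + k <= m + u ->
  n ^_ m * (n - m - u) ^ k <= n ^_ (m + k).
Proof.
rewrite leq_add2l; elim: k => [|k IHk] ku; first by rewrite expn0 muln1 addn0.
rewrite addnS ffactnSr expnSr mulnA; apply: leq_mul; last lia.
by apply: IHk; apply: ltnW.
Qed.

Section ColouredEmbeddings.
Variables (H : sgraph) (a b : nat) (chi : {ffun H -> bool}).
Hypothesis chiC : chi \in proper_colourings H.
Let T1 := {v : H | chi v}.
Let T2 := {v : H | ~~ chi v}.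

Definition glue (gh : {ffun T1 -> 'I_a} * {ffun T2 -> 'I_b}) :
    {ffun H -> Kab a b} :=
  [ffun v => match boolP (chi v) with
             | AltTrue e => inl (gh.1 (exist _ v e))
             | AltFalse e => inr (gh.2 (exist _ v e))
             end].

Lemma glue1 gh (v : T1) : glue gh (val v) = inl (gh.1 v).
Proof.
rewrite ffunE; case: {-}_ / boolP => e.
  by congr (inl (gh.1 _)); apply: val_inj.
by have := e; rewrite (valP v).
Qed.

Lemma glue2 gh (v : T2) : glue gh (val v) = inr (gh.2 v).
Proof.
rewrite ffunE; case: {-}_ / boolP => e.
  by have := valP v; rewrite e.
by congr (inr (gh.2 _)); apply: val_inj.
Qed.

Lemma left_side_glue gh v : left_side (glue gh v) = chi v.
Proof. by rewrite ffunE; case: {-}_ / boolP => e /=; rewrite ?e ?(negbTE e). Qed.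

Lemma card_coloured :
  a ^_ #|{: T1}| * b ^_ #|{: T2}| <=
  #|[set f in embeddings H (Kab a b) | [ffun v => left_side (f v)] == chi]|.
Proof.
rewrite -[X in X ^_ _ * _]card_ord -[X in _ * X ^_ _]card_ord -!card_inj_ffuns -cardsX.
rewrite -(card_imset (f := glue)); last first.
  move=> [g h] [g' h'] E; congr pair; apply/ffunP => v.
    have : glue (g, h) (val v) = glue (g', h') (val v) by rewrite E.
    by rewrite !glue1; case.
  have : glue (g, h) (val v) = glue (g', h') (val v) by rewrite E.
  by rewrite !glue2; case.
apply: subset_leq_card; apply/subsetP => f /imsetP[[g h] ghI ->].
have [/injectiveP gI /injectiveP hI] : injectiveb g /\ injectiveb h.
  by move: ghI; rewrite !inE => /andP.
rewrite !inE -andbA.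
apply/and3P; split; last by apply/eqP/ffunP => v; rewrite ffunE left_side_glue.
  apply/injectiveP => u v E.
  have ec : chi u = chi v by rewrite -!(left_side_glue (g, h)) E.
  move: E; case: (boolP (chi u)) => cu.
    have cv := cu; rewrite ec in cv.
    rewrite (glue1 (g, h) (exist _ u cu)) (glue1 (g, h) (exist _ v cv)) /=.
    by case=> /gI; case.
  have cv := cu; rewrite ec in cv.
  rewrite (glue2 (g, h) (exist _ u cu)) (glue2 (g, h) (exist _ v cv)) /=.
  by case=> /hI; case.
apply/forallP => u; apply/forallP => v.
move: chiC; rewrite inE => /forallP/(_ u)/forallP/(_ v).
by case: (adj u v) => //=; rewrite /adj /= /Kab_adj !left_side_glue.
Qed.
End ColouredEmbeddings.

(** A proper colouring prescribes the sides.  A matching provides [x] vertices of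
    each colour; each of the other [u] vertices finds at least [a - x - u] free
    places on its side. *)
Lemma embeddings_Kab_ge (H : sgraph) (a b x u : nat) :
  #|H| = x + x + u -> a <= b ->
  (forall chi : {ffun H -> bool}, chi \in proper_colourings H ->
     x <= #|[pred v | chi v]| /\ x <= #|[pred v | ~~ chi v]|) ->
  #|proper_colourings H| * (a ^_ x * b ^_ x * (a - x - u) ^ u) <= #|embeddings H (Kab a b)|.
Proof.
move=> cH ab hx.
rewrite -[X in _ <= X]sum1_card.
rewrite (partition_big (fun f : {ffun H -> Kab a b} => [ffun v => left_side (f v)])
   (fun chi => chi \in proper_colourings H)); last first.
  move=> f fE; have [fI fH] := elimT (@embeddingsP H (Kab a b) f) fE; rewrite inE.
  apply/forallP => v; apply/forallP => w; apply/implyP => /fH.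
  by rewrite !ffunE.
rewrite -sum_nat_const; apply: leq_sum => chi chiC.
rewrite sum1_card; apply: leq_trans (leq_trans (card_coloured a b chiC) _); last first.
  by apply: subset_leq_card; apply/subsetP => f; rewrite inE.
have [h1 h2] := hx chi chiC.
rewrite !card_sig.
have : #|[pred v | chi v]| + #|[pred v | ~~ chi v]| =
  #|H| by rewrite -(cardC [pred v | chi v]).
rewrite cH -(subnKC h1) -(subnKC h2).
set p := _ - x; set q := _ - x => E.
have Eu : p + q = u by lia.
have e1 : a ^_ x * (a - x - u) ^ p <= a ^_ (x + p) by apply: ffact_ge; lia.
have e2 : b ^_ x * (b - x - u) ^ q <= b ^_ (x + q) by apply: ffact_ge; lia.
apply: leq_trans (leq_mul e1 e2).
rewrite -Eu expnD mulnACA leq_mul2l; apply/orP; right.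
rewrite leq_mul2l; apply/orP; right.
case: (q) => // k; rewrite leq_exp2r //; lia.
Qed.

(** * Degrees in triangle-free graphs *)

Section TriangleFree.
Variable G : sgraph.
Hypothesis tf : triangle_free G.

Definition nbrs (v : G) : {set G} := [set w | adj v w].
Definition degree v := #|nbrs v|.
(** Twice the number of edges. *)
Definition arcs := \sum_v degree v.
(** The subtraction is exact at edges of a triangle-free graph ([slackK]). *)
Definition slack (e : G * G) := #|G| - degree e.1 - degree e.2.

Lemma nbrs_disj u v : adj u v -> [disjoint nbrs u & nbrs v].
Proof.
move=> uv; rewrite -setI_eq0; apply/eqP/setP => w; rewrite !inE; apply/negP.
by case/andP => uw vw; apply: (tf (u := u) (v := v) (w := w)).
Qed.

Lemma deg_edge u v : adj u v -> degree u + degree v <= #|G|.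
Proof. by move/nbrs_disj; rewrite -leq_card_setU => /eqP <-; apply: max_card. Qed.

Lemma slackK u v : adj u v -> degree u + degree v + slack (u, v) = #|G|.
Proof. by move=> /deg_edge; rewrite /slack /=; lia. Qed.

(** If the neighbourhoods of [u] and [v] cover [G], they are a bipartition,
    being independent and disjoint. *)
Lemma slack_gt0 u v : ~ bipartite G -> adj u v -> 0 < slack (u, v).
Proof.
move=> nb uv; rewrite lt0n; apply/eqP => E; apply: nb; exists (nbrs u).
have U : nbrs u :|: nbrs v = setT.
  apply/eqP; rewrite eqEcard subsetT cardsT cardsU.
  have -> : nbrs u :&: nbrs v = set0 by apply/disjoint_setI0/nbrs_disj.
  by rewrite cards0 subn0 -(slackK uv) E addn0 leqnn.
have key w : (w \in nbrs v) = (w \notin nbrs u).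
  have := in_setT w; rewrite -U inE; case: (boolP (w \in nbrs u)) => //= wu _.
  by apply/negP => wv; have := disjointFr (nbrs_disj uv) wu; rewrite wv.
move=> w z wz; apply/eqP => E1.
have : (w \in nbrs u) = (z \in nbrs u) by [].
case: (boolP (z \in nbrs u)) => zu wu.
  by move: wu zu; rewrite !inE => wu zu; apply: (tf (u := u) (v := w) (w := z)).
have : w \in nbrs v by rewrite key wu.
have : z \in nbrs v by rewrite key zu.
by rewrite !inE => zv wv; apply: (tf (u := v) (v := w) (w := z)).
Qed.

Lemma arcsE : arcs = \sum_(e : G * G | adj e.1 e.2) 1.
Proof.
rewrite -(pair_big_dep xpredT (fun u v => adj u v) (fun u v => 1)) /=.
by apply: eq_bigr => u _; rewrite sum1_card /degree; apply: eq_card => v; rewrite inE.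
Qed.

Lemma sum_arc1 (F : G -> nat) : \sum_(e : G * G | adj e.1 e.2) F e.1 =
  \sum_v degree v * F v.
Proof.
rewrite -(pair_big_dep xpredT (fun u v => adj u v) (fun u v => F u)) /=.
apply: eq_bigr => u _; rewrite -sum_nat_const; apply: eq_bigl => v; by rewrite inE.
Qed.

Lemma sum_arc_sym (F : G -> G -> nat) :
  \sum_(e : G * G | adj e.1 e.2) F e.1 e.2 = \sum_(e : G * G | adj e.1 e.2) F e.2 e.1.
Proof.
rewrite (reindex (fun e : G * G => (e.2, e.1))) /=; last first.
  by exists (fun e : G * G => (e.2, e.1)) => -[].
by apply: eq_bigl => e; rewrite adj_sym.
Qed.

(** The neighbourhood of [v] is independent, so each edge has an end among the
    [#|G| - degree v] other vertices. *)
Lemma arcs_maxdeg v : (forall w, degree w <= degree v) ->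
  arcs <= 2 * (degree v * (#|G| - degree v)).
Proof.
move=> mx.
have le : \sum_(u in nbrs v) degree u <= \sum_(u in ~: nbrs v) degree u.
  have E (A : {set G}) : \sum_(u in A) degree u =
    \sum_(e : G * G | adj e.1 e.2) (e.1 \in A).
    rewrite (sum_arc1 (fun u => u \in A : nat)) big_mkcond; apply: eq_bigr => u _.
    by case: (u \in A); rewrite ?muln1 ?muln0.
  rewrite !E (sum_arc_sym (fun u w => (u \in ~: nbrs v) : nat)).
  apply: leq_sum => -[u w] /= uw; rewrite !inE.
  case: (boolP (adj v u)) => // vu; case: (boolP (adj v w)) => // vw.
  by exfalso; apply: (tf (u := v) (v := u) (w := w)).
have le2 : \sum_(u in ~: nbrs v) degree u <= degree v * (#|G| - degree v).
  have : #|~: nbrs v| = #|G| - degree v by rewrite cardsCs setCK.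
  by rewrite mulnC => <-; rewrite -sum_nat_const; apply: leq_sum.
have : arcs = \sum_(u in nbrs v) degree u + \sum_(u in ~: nbrs v) degree u.
  rewrite /arcs (bigID (mem (nbrs v))) /=; congr (_ + _).
  by apply: eq_bigl => u; rewrite [RHS]inE.
by lia.
Qed.

Lemma sum_slack : \sum_(e : G * G | adj e.1 e.2) slack e + 2 * \sum_v degree v * degree v =
  #|G| * arcs.
Proof.
have E1 := sum_arc1 degree; have E2 := sum_arc_sym (fun u v => degree u).
rewrite mul2n -addnn -{1}E1 -E1 E2 arcsE big_distrr /= -E2 {2}E2 -!big_split /=.
by apply: eq_bigr => -[u v] /= uv; rewrite muln1 -(slackK uv); lia.
Qed.

Lemma arcs_sq_le : arcs ^ 2 <= #|G| * \sum_v degree v * degree v.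
Proof.
rewrite /arcs -mulnn big_distrl /=.
have E : \sum_i degree i * \sum_j degree j = \sum_(i : G) \sum_(j : G) degree i * degree j.
  by apply: eq_bigr => i _; rewrite big_distrr.
have F : \sum_(i : G) \sum_(j : G) (degree i * degree i + degree j * degree j) =
   2 * (#|G| * \sum_v degree v * degree v).
  have -> : \sum_(i : G) \sum_(j : G) (degree i * degree i + degree j * degree j) =
     \sum_(i : G) (#|G| * (degree i * degree i) + \sum_v degree v * degree v).
    by apply: eq_bigr => i _; rewrite big_split /= sum_nat_const.
  by rewrite big_split /= sum_nat_const -big_distrr /= mul2n addnn.
rewrite -(leq_pmul2l (isT : 0 < 2)) -F E big_distrr /=.
apply: leq_sum => i _; rewrite big_distrr /=; apply: leq_sum => j _.
by rewrite !mulnn; case: (nat_Cauchy (degree i) (degree j)).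
Qed.

Lemma arcs_le : 2 * arcs <= #|G| ^ 2.
Proof.
have := arcs_sq_le; have := sum_slack.
set S := \sum_(e : G * G | adj e.1 e.2) slack e;
  set Q := \sum_v degree v * degree v => h1 h2.
have [->|a0] := posnP arcs; first by rewrite muln0.
rewrite -(leq_pmul2l a0); nia.
Qed.

(** Four times the distance of the number of edges to Mantel's bound. *)
Definition gap := #|G| ^ 2 - 2 * arcs.

Lemma gapE : gap + 2 * arcs = #|G| ^ 2.
Proof. by rewrite /gap subnK // arcs_le. Qed.

(** By Cauchy-Schwarz the ends of the edges have mean degree at least
    [arcs / #|G|], which leaves little slack when the number of edges is close to
    Mantel's bound. *)
Lemma sum_slack_le : #|G| * \sum_(e : G * G | adj e.1 e.2) slack e <= arcs * gap.
Proof.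
have := arcs_sq_le; have := sum_slack; have := gapE.
set S := \sum_(e : G * G | adj e.1 e.2) slack e; set Q := \sum_v degree v * degree v; nia.
Qed.

(** Each slack is at least one, their mean at most [gap / #|G|]. *)
Lemma gap_ge : ~ bipartite G -> #|G| <= gap.
Proof.
move=> nb.
have h : arcs <= \sum_(e : G * G | adj e.1 e.2) slack e.
  by rewrite arcsE; apply: leq_sum => -[u v] /= uv; apply: slack_gt0.
have [a0|a0] := posnP arcs.
  case: nb; exists set0 => u v uv.
  have : 0 < arcs by rewrite arcsE (bigD1 (u, v)).
  by rewrite a0.
rewrite -(leq_pmul2l a0); apply: leq_trans sum_slack_le.
by rewrite mulnC leq_mul2l h orbT.
Qed.

(** The bound [arcs_maxdeg], as [(2 * degree v - #|G|) ^ 2 <= gap] without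
    subtraction. *)
Lemma gap_maxdeg v : (forall w, degree w <= degree v) ->
  (2 * degree v) ^ 2 + #|G| ^ 2 <= gap + 4 * (degree v * #|G|).
Proof.
move=> /arcs_maxdeg h; have := gapE.
have : degree v <= #|G| by apply: max_card.
move: h; set d := degree v; set a := arcs; set g := gap; set n := #|G|; nia.
Qed.

End TriangleFree.

(** * Ordered matchings *)

Definition ends (T : Type) (s : seq (T * T)) : seq T :=
  flatten [seq [:: e.1; e.2] | e <- s].

Lemma sum_ends (T : Type) (s : seq (T * T)) (F : T -> nat) :
  \sum_(v <- ends s) F v = \sum_(e <- s) (F e.1 + F e.2).
Proof.
elim: s => [|e s IHs]; first by rewrite !big_nil.
by rewrite /ends /= !big_cons -/(ends s) IHs addnA.
Qed.

Lemma sum_seq_const (T : Type) (s : seq T) c : \sum_(x <- s) c = size s * c.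
Proof. by rewrite big_const_seq count_predT iter_addn_0 mulnC. Qed.

Lemma size_ends (T : Type) (s : seq (T * T)) : size (ends s) = 2 * size s.
Proof. by elim: s => //= e s IHs; rewrite /ends /= -/(ends s) IHs mulnS. Qed.

Lemma sum_tupleS (T : finType) k (F : seq T -> nat) :
  \sum_(s : k.+1.-tuple T) F s = \sum_(s : k.-tuple T) \sum_(x : T) F (x :: s).
Proof.
rewrite pair_big /=.
rewrite (reindex (fun p : k.-tuple T * T => [tuple of p.2 :: p.1])) //=.
exists (fun s : k.+1.-tuple T => ([tuple of behead s], thead s)).
  by move=> [s x] _; congr pair; apply: val_inj.
by move=> s _; rewrite [RHS](tuple_eta s).
Qed.

Section Matchings.
Variable G : sgraph.
Hypothesis tf : triangle_free G.

(** Each edge is counted in one of its two orientations only. *)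
Definition oriented_edge (e : G * G) := adj e.1 e.2 && (enum_rank e.1 < enum_rank e.2).

Definition is_ordered_matching (s : seq (G * G)) := all oriented_edge s && uniq (ends s).

Definition ordered_matchings k : {set k.-tuple (G * G)} := [set s :
  k.-tuple (G * G) | is_ordered_matching s].

Definition misses (s : seq (G * G)) (e :
  G * G) := (e.1 \notin ends s) && (e.2 \notin ends s).

Definition total_slack (s : seq (G * G)) := \sum_(e <- s) slack e.

Lemma sum_oriented (F : G -> G -> nat) : (forall u v, F u v = F v u) ->
  \sum_(e : G * G | adj e.1 e.2) F e.1 e.2 = 2 * \sum_(e | oriented_edge e) F e.1 e.2.
Proof.
move=> sF; rewrite (bigID (fun e : G * G => enum_rank e.1 < enum_rank e.2)) /=.
rewrite mul2n -addnn; congr (_ + _).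
rewrite (reindex (fun e : G * G => (e.2, e.1))) /=; last first.
  by exists (fun e : G * G => (e.2, e.1)) => -[].
apply: eq_big => [[u v]|[u v] _] /=; last exact: sF.
rewrite /oriented_edge /= adj_sym; case: (boolP (adj u v)) => //= uv.
rewrite -leqNgt leq_eqVlt; case: eqP => // E.
by move: uv; rewrite (enum_rank_inj (val_inj E)) adj_irr.
Qed.

Lemma is_ordered_matching_cons x s : is_ordered_matching (x :: s) =
  [&& oriented_edge x, misses s x & is_ordered_matching s].
Proof.
rewrite /is_ordered_matching /misses /ends /= -/(ends s) !inE negb_or.
case: (boolP (oriented_edge x)) => //= /andP[xa _].
have -> : x.1 != x.2 by apply/eqP => E; rewrite E adj_irr in xa.
by rewrite /=; do !bool_congr.
Qed.

Lemma card_ordered_matchings k : #|ordered_matchings k| =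
  \sum_(s : k.-tuple (G * G)) is_ordered_matching s.
Proof. by rewrite -sum1_card big_mkcond; apply: eq_bigr => s _; rewrite inE;
  case: is_ordered_matching. Qed.

Definition num_disjoint_edges s := \sum_(e | oriented_edge e) misses s e.

Lemma card_ordered_matchingsS k : #|ordered_matchings k.+1| =
  \sum_(s in ordered_matchings k) num_disjoint_edges s.
Proof.
rewrite card_ordered_matchings (sum_tupleS k (fun s =>
  is_ordered_matching s)) [RHS]big_mkcond /=.
apply: eq_bigr => s _; rewrite inE /num_disjoint_edges.
case: (boolP (is_ordered_matching s)) => gs; last first.
  by apply: big1 => x _; rewrite is_ordered_matching_cons (negbTE gs) !andbF.
by rewrite [RHS]big_mkcond; apply: eq_bigr => x _;
  rewrite is_ordered_matching_cons gs andbT; case: oriented_edge.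
Qed.

Definition num_edges := \sum_(e | oriented_edge e) 1.

Lemma num_edgesE : 2 * num_edges = arcs G.
Proof. by rewrite arcsE (sum_oriented (F := fun _ _ => 1)). Qed.

Lemma card_ordered_matchings_le k : #|ordered_matchings k| <= num_edges ^ k.
Proof.
elim: k => [|k IHk]; first by rewrite expn0 (leq_trans (max_card _)) // card_tuple expn0.
rewrite card_ordered_matchingsS expnSr; apply: leq_trans (leq_mul IHk (leqnn _)).
rewrite -sum_nat_const; apply: leq_sum => s _; apply: leq_sum => e _; exact: leq_b1.
Qed.

(** One edge of the matching carries the slack, the other [k.-1] are arbitrary;
    the factor [num_edges] on the left stands for the missing exponent. *)
Lemma sum_total_slack_le k :
  \sum_(s in ordered_matchings k) total_slack s * num_edges <=
    k * (\sum_(e | oriented_edge e) slack e) * num_edges ^ k.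
Proof.
elim: k => [|k IHk].
  by rewrite mul0n leqn0 big1 // => s _; rewrite tuple0 /total_slack big_nil.
set T := \sum_(e | oriented_edge e) _ in IHk *.
have -> : \sum_(s in ordered_matchings k.+1) total_slack s * num_edges =
   \sum_(s in ordered_matchings k) \sum_(x | oriented_edge x && misses s x) (slack x +
     total_slack s) * num_edges.
  rewrite big_mkcond (eq_bigr (fun s :
    k.+1.-tuple (G * G) => (fun s => is_ordered_matching s * (total_slack s * num_edges)) (tval s))) /=; last first.
    by move=> s _; rewrite inE; case: is_ordered_matching; rewrite ?mul1n.
  rewrite (sum_tupleS k (fun s => is_ordered_matching s * (total_slack s * num_edges))) [RHS]big_mkcond.
  apply: eq_bigr => s _; rewrite inE; case: (boolP (is_ordered_matching s)) => gs;
    last first.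
    by apply: big1 => x _; rewrite is_ordered_matching_cons (negbTE gs) !andbF.
  rewrite [RHS]big_mkcond; apply: eq_bigr => x _; rewrite is_ordered_matching_cons gs andbT.
  by case: ifP => _; rewrite ?mul1n // /total_slack big_cons.
apply: (@leq_trans (\sum_(s in ordered_matchings k) (T +
  num_edges * total_slack s) * num_edges)).
  apply: leq_sum => s _; rewrite -big_distrl /= leq_mul2r; apply/orP; right.
  have -> : T + num_edges * total_slack s =
    \sum_(x | oriented_edge x) (slack x + total_slack s).
    rewrite big_split /= /num_edges big_distrl /=; congr (_ + _).
    by apply: eq_bigr => x _; rewrite mul1n.
  by rewrite [X in X <= _]big_mkcondr /=; apply: leq_sum => x _; case: ifP.
have -> : \sum_(s in ordered_matchings k) (T + num_edges * total_slack s) * num_edges =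
  #|ordered_matchings k| * (T * num_edges) + num_edges * \sum_(s in
    ordered_matchings k) total_slack s * num_edges.
  rewrite (eq_bigr (fun s : k.-tuple (G * G) =>
    T * num_edges + num_edges * (total_slack s * num_edges))).
    by rewrite big_split /= sum_nat_const -big_distrr.
  by move=> s _; rewrite mulnDl mulnA.
have -> : k.+1 * T * num_edges ^ k.+1 =
   num_edges ^ k * (T * num_edges) + num_edges * (k * T * num_edges ^ k).
  by rewrite expnS; ring.
by rewrite leq_add ?leq_mul ?card_ordered_matchings_le.
Qed.

(** The edges meeting [s] are counted through the degrees of the [2 * k] ends.
    The edges counted twice join two ends; they are few because a vertex is
    adjacent to at most one end of each edge of [s]. *)
Lemma num_disjoint_edges_le (k : nat) (s : k.-tuple (G * G)) : s \in ordered_matchings k ->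
  4 * num_disjoint_edges s + gap G <= (#|G| - 2 * k) ^ 2 + 4 * total_slack s.
Proof.
rewrite inE => /andP[/allP sE sU].
have sz : size (ends s) = 2 * k by rewrite size_ends size_tuple.
have k2 : 2 * k <= #|G| by rewrite -sz -(card_uniqP sU); apply: max_card.
have adjs e : e \in tval s -> adj e.1 e.2 by move=> /sE /andP[].
(* The two vertices of an edge of s have no common neighbour. *)
have c1 (u : G) : \sum_(v <- ends s) adj u v <= k.
  rewrite sum_ends -[X in _ <= X](size_tuple s) -sum1_size big_seq [X in _ <= X]big_seq.
  apply: leq_sum => e /adjs ae; case: (boolP (adj u e.1)) => u1;
    case: (boolP (adj u e.2)) => u2 //.
  by exfalso; apply: (tf (u := u) (v := e.1) (w := e.2)).
have c2 : \sum_(e : G * G | adj e.1 e.2) ((e.1 \in ends s) && (e.2 \in ends s) : nat) <=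
  2 * k * k.
  rewrite -(pair_big_dep xpredT (fun u v => adj u v) (fun u v =>
    (u \in ends s) && (v \in ends s) : nat)) /=.
  apply: (@leq_trans (\sum_(u <- ends s) k)); last by rewrite sum_seq_const sz.
  rewrite (bigID (fun u => u \in ends s)) /= [X in _ + X]big1 ?addn0; last first.
    by move=> u /negbTE ->; rewrite big1.
  rewrite -(big_uniq _ sU) /=; apply: leq_sum => u _; apply: leq_trans (c1 u).
  rewrite (big_uniq _ sU) /= big_mkcond [X in _ <= X]big_mkcond /=; apply: leq_sum => v _.
  by case: (adj u v) => //=; case: (v \in ends s); rewrite ?andbF ?andbT ?leq_b1.
have c3 : 2 * num_disjoint_edges s = \sum_(e : G * G | adj e.1 e.2) (misses s e : nat).
  rewrite (sum_oriented (F := fun u v => misses s (u, v))) /=.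
    by congr (2 * _); apply: eq_bigr => -[].
  by move=> u v; rewrite /misses andbC.
have c4 : \sum_(e : G * G | adj e.1 e.2) (misses s e :
  nat) + 2 * \sum_(v <- ends s) degree v =
  arcs G + \sum_(e : G * G | adj e.1 e.2) ((e.1 \in ends s) && (e.2 \in ends s) : nat).
  have E : \sum_(v <- ends s) degree v = \sum_(e : G * G | adj e.1 e.2) (e.1 \in ends s).
    rewrite (sum_arc1 (fun u => u \in ends s : nat)) (big_uniq _ sU) /= big_mkcond.
    by apply: eq_bigr => u _; case: (u \in ends s); rewrite ?muln1 ?muln0.
  have E2 := sum_arc_sym (fun u w => (u \in ends s) : nat).
  rewrite mul2n -addnn {2}E E E2 -E2 {2}E2 arcsE -!big_split /=.
  apply: eq_bigr => -[u v] _; rewrite /misses /=.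
  by case: (u \in ends s); case: (v \in ends s).
have c5 : \sum_(v <- ends s) degree v + total_slack s = k * #|G|.
  rewrite sum_ends /total_slack -big_split /= -[X in X * _](size_tuple s) -sum_seq_const.
  rewrite big_seq [RHS]big_seq; apply: eq_bigr => -[u v] /adjs uv.
  exact: slackK.
have := gapE tf; rewrite -/(arcs G).
move: c2 c3 c4 c5 k2; set S := \sum_(e | adj e.1 e.2) _.
set S2 := \sum_(e : G * G | adj e.1 e.2) _; set S3 := \sum_(v <- _) _.
move: (total_slack s) (num_disjoint_edges s) (arcs G) (gap G) #|G| => sl av a g n.
move=> h1 h2 h3 h4 h5 h6.
have : (n - 2 * k) ^ 2 + 4 * (k * n) = n ^ 2 + 4 * (k * k) by nia.
lia.
Qed.

Lemma ordered_matchings_step k :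
  4 * #|ordered_matchings k.+1| + gap G * #|ordered_matchings k| <=
  (#|G| - 2 * k) ^ 2 * #|ordered_matchings k| + 4 * \sum_(s in
    ordered_matchings k) total_slack s.
Proof.
rewrite card_ordered_matchingsS !big_distrr /= mulnC (mulnC _ #|ordered_matchings k|) -!sum_nat_const -!big_split /=.
by apply: leq_sum => s; apply: num_disjoint_edges_le.
Qed.

Lemma sum_total_slack_gap k : #|G| * \sum_(s in ordered_matchings k) total_slack s <=
  k * gap G * num_edges ^ k.
Proof.
have [e0|e0] := posnP num_edges.
  rewrite big1 ?muln0 // => s; rewrite inE => /andP[/allP sE _].
  rewrite /total_slack big_seq big1 // => e /sE le.
  by have : 0 < num_edges by [rewrite /num_edges (bigD1 e)]; rewrite e0.
have h1 := sum_total_slack_le k; have h2 := sum_slack_le tf; have h3 := num_edgesE.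
have h4 : \sum_(e : G * G | adj e.1 e.2) slack e = 2 * \sum_(e | oriented_edge e) slack e.
  rewrite (eq_bigr (fun e : G * G => slack (e.1, e.2))); last by case.
  rewrite (sum_oriented (F := fun u v => slack (u, v))).
    by congr (2 * _); apply: eq_bigr => -[].
  by move=> u v; rewrite /slack /= -!subnDA addnC.
rewrite -big_distrl /= in h1; rewrite h4 -h3 in h2.
set X := \sum_(s in _) _ in h1 *; set T := \sum_(e | oriented_edge e) _ in h1 h2.
have h5 : #|G| * T <= num_edges * gap G by lia.
rewrite -(leq_pmul2r e0) -mulnA.
apply: leq_trans (leq_mul (leqnn #|G|) h1) _.
have -> : #|G| * (k * T * num_edges ^ k) = (k * num_edges ^ k) * (#|G| * T) by ring.
have -> : k * gap G * num_edges ^ k * num_edges =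
  (k * num_edges ^ k) * (num_edges * gap G) by ring.
by rewrite leq_mul.
Qed.

End Matchings.

(** * From matchings to embeddings *)

Lemma mem_ends (T : eqType) (s : seq (T * T)) v :
  reflect (exists2 e, e \in s & (v == e.1) || (v == e.2)) (v \in ends s).
Proof.
apply: (iffP flatten_mapP) => -[e es]; rewrite ?inE => ve; exists e => //.
by rewrite !inE.
Qed.

Section EmbeddingsVsMatchings.
Variables (H G : sgraph) (x : nat) (P : x.-tuple (H * H)).
Hypothesis tf : triangle_free G.
Hypothesis Padj : all (fun e => adj e.1 e.2) P.
Hypothesis Puniq : uniq (ends P).
Hypothesis Pmax : forall u v : H, adj u v -> (u \in ends P) || (v \in ends P).
Hypothesis Hbip : bipartite H.
Variables (g0 : G) (D D' : nat).
Hypothesis DD' : D + D' = #|G| - 2 * x.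
Hypothesis D'D : D' <= D.
Hypothesis Ddeg : forall g : G, minn (#|G| - 2 * x) (degree g) <= D.

Definition orient (a b : G) := if enum_rank a < enum_rank b then (a, b) else (b, a).

Definition trace (f : {ffun H -> G}) : x.-tuple (G * G) :=
  [tuple of [seq orient (f e.1) (f e.2) | e <- P]].

Lemma perm_ends_trace (f : {ffun H -> G}) (s : seq (H * H)) :
  perm_eq (ends [seq orient (f e.1) (f e.2) | e <- s]) [seq f v | v <- ends s].
Proof.
elim: s => //= e s IHs; rewrite /ends /= -!/(ends _).
rewrite /orient; case: ifP => _ /=; first by rewrite !perm_cons.
apply: (@perm_trans _ (f e.1 :: f e.2 :: ends [seq orient (f e.1) (f e.2) | e <- s])).
  by apply/permPl; apply: (perm_catCA [:: f e.2] [:: f e.1]).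
by rewrite !perm_cons.
Qed.

Lemma trace_ordered_matching f : f \in embeddings H G -> trace f \in ordered_matchings G x.
Proof.
move=> /embeddingsP[fI fH]; rewrite inE /is_ordered_matching; apply/andP; split; last first.
  by rewrite (perm_uniq (perm_ends_trace f P)) map_inj_uniq.
apply/allP => _ /mapP[e eP ->]; have /fH := allP Padj e eP.
rewrite /orient /oriented_edge; case: ifP => /= [-> -> //|].
move=> /negbT; rewrite -leqNgt leq_eqVlt => /orP[/eqP E|->].
  by rewrite (enum_rank_inj (val_inj E)) adj_irr.
by rewrite adj_sym => ->.
Qed.

Section Lists.
Variable t : x.-tuple (G * G).
Hypothesis tmo : t \in ordered_matchings G x.

(** Where an embedding with trace [t] may put [v].  Quantifying over all pairs
    avoids naming the pair that contains [v]. *)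
Definition lists (v : H) : {set G} :=
  [set g | [forall j : 'I_x, ((v == (tnth P j).1) || (v == (tnth P j).2)) ==>
                ((g == (tnth t j).1) || (g == (tnth t j).2))]
           && ((v \notin ends P) ==> (g \notin ends t))].

Lemma lists_matched v : v \in ends P ->
  exists p q, adj p q /\ lists v \subset [set p; q].
Proof.
case/mem_ends => e /tnthP[j ->] ve.
exists (tnth t j).1, (tnth t j).2; split.
  have : tnth t j \in t := mem_tnth j t.
  by move: tmo; rewrite inE => /andP[/allP h _] /h /andP[].
apply/subsetP => g; rewrite !inE => /andP[/forallP/(_ j)/implyP/(_ ve)].
by [].
Qed.

Lemma lists_unmatched v : v \notin ends P -> lists v \subset ~: [set g in ends t].
Proof.
by move=> vP; apply/subsetP => g; rewrite !inE vP => /andP[].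
Qed.

Lemma card_free : #|~: [set g in ends t]| = D + D'.
Proof.
have fU : uniq (ends t) by move: tmo; rewrite inE => /andP[].
by rewrite cardsCs setCK cardsE (card_uniqP fU) size_ends size_tuple DD'.
Qed.

Lemma lists_bound :
  2 * #|[set f in embeddings H G | trace f == t]| <=
  #|proper_colourings H| * (D ^ (#|H| - 2 * x) + D' ^ (#|H| - 2 * x)).
Proof.
have mtE : #|~: [set v in ends P]| = #|H| - 2 * x.
  by rewrite cardsCs setCK cardsE (card_uniqP Puniq) size_ends size_tuple.
rewrite -mtE; apply: leq_trans (list_hom_bound (L := lists) g0 _ _ _ _ _ _ D'D Hbip).
- rewrite leq_mul2l; apply/orP; right; apply: subset_leq_card.
  apply/subsetP => f; rewrite inE => /andP[/embeddingsP[fI fH] /eqP E].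
  rewrite inE; apply/andP; split; last first.
    by apply/forallP => u; apply/forallP => v; apply/implyP/fH.
  apply/forallP => v; rewrite inE; apply/andP; split.
    apply/forallP => j; apply/implyP => vj; rewrite -E tnth_map /orient.
    by case: ifP => _ /=; case/orP: vj => /eqP ->; rewrite eqxx ?orbT.
  apply/implyP => vP; rewrite -E (perm_mem (perm_ends_trace f P)).
  by apply/negP => /mapP[w wP /fI vw]; rewrite vw wP in vP.
- move=> v g; rewrite inE => /lists_matched[p [q [pq /subsetP s]]].
  case: (boolP (adj g p)) => gp.
    rewrite -(cards1 p); apply: subset_leq_card; apply/subsetP => z;
      rewrite inE => /andP[/s].
    rewrite !inE => /orP[//|/eqP -> gq].
    by exfalso; apply: (tf (u := g) (v := p) (w := q)).
  rewrite -(cards1 q); apply: subset_leq_card; apply/subsetP => z;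
    rewrite inE => /andP[/s].
  by rewrite !inE => /orP[/eqP ->|//]; rewrite (negbTE gp).
- move=> v; rewrite inE => /lists_matched[p [q [pq s]]].
  by apply: leq_trans (subset_leq_card s) _; rewrite cards2; case: eqP.
- move=> w; rewrite inE => /lists_unmatched s.
  by rewrite -card_free; apply: subset_leq_card.
- move=> v w g _; rewrite inE => /lists_unmatched s _.
  apply: leq_trans (Ddeg g); rewrite leq_min -DD' -card_free; apply/andP; split.
    apply: leq_trans (subset_leq_card s); apply: subset_leq_card.
    by apply/subsetP => z; rewrite inE => /andP[].
  by apply: subset_leq_card; apply/subsetP => z; rewrite !inE => /andP[].
- move=> v w; rewrite !inE => /lists_matched[p [q [pq s]]] /lists_unmatched s'.
  apply: (@leq_trans (\sum_(g in [set p; q]) #|[set g' in lists w | adj g g']|)).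
    rewrite big_mkcond [X in _ <= X]big_mkcond; apply: leq_sum => g _.
    by case: ifP => // gv; rewrite (subsetP s _ gv).
  have npq : p != q by apply/eqP => E; rewrite E adj_irr in pq.
  rewrite big_setU1 ?inE //= big_set1.
  rewrite -card_free; apply: leq_trans (subset_leq_card s').
  have : [disjoint [set g' in lists w | adj p g'] & [set g' in lists w | adj q g']].
    apply: disjointWr (_ : _ \subset nbrs q) _; first by apply/subsetP => z;
      rewrite !inE => /andP[].
    apply: disjointWl (_ : _ \subset nbrs p) _; first by apply/subsetP => z;
      rewrite !inE => /andP[].
    exact: nbrs_disj.
  rewrite -leq_card_setU => /eqP <-; apply: subset_leq_card.
  by apply/subsetP => z; rewrite !inE => /orP[] /andP[].
- by move=> u v; rewrite !inE; apply: Pmax.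
Qed.

End Lists.

Lemma embeddings_le_matchings :
  2 * #|embeddings H G| <=
  #|ordered_matchings G x| * (#|proper_colourings H| * (D ^ (#|H| - 2 * x) +
    D' ^ (#|H| - 2 * x))).
Proof.
rewrite -sum1_card (partition_big trace (fun t => t \in ordered_matchings G x)) /=;
  last exact: trace_ordered_matching.
rewrite big_distrr -sum_nat_const; apply: leq_sum => t tm.
by apply: leq_trans (lists_bound tm); rewrite leq_mul2l /= sum1_card;
  apply/subset_leq_card/subsetP => f; rewrite inE.
Qed.

End EmbeddingsVsMatchings.

(** * Numerical estimates *)

Section Numerics.
Local Open Scope ring_scope.
Variable R : realFieldType.
Implicit Types (t y d : R) (k m : nat).

Lemma bernoulli_sub t k : 0 <= t <= 1 -> 1 - k%:R * t <= (1 - t) ^+ k.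
Proof.
move=> /andP[t0 t1]; elim: k => [|k IHk]; first by rewrite expr0 mul0r subr0.
have : (1 - t) * (1 - k%:R * t) <= (1 - t) ^+ k.+1.
  by rewrite exprS ler_wpM2l // subr_ge0.
apply: le_trans; rewrite -natr1.
have : 0 <= k%:R * t ^+ 2 by rewrite mulr_ge0 // sqr_ge0.
nra.
Qed.

Lemma bernoulli_inv t k : 0 <= t <= 1 -> (1 - t) ^+ k * (1 + k%:R * t) <= 1.
Proof.
move=> /andP[t0 t1]; elim: k => [|k IHk]; first by rewrite expr0 mul0r addr0 mulr1.
have h0 : 0 <= (1 - t) ^+ k by rewrite exprn_ge0 // subr_ge0.
have kt : 0 <= k%:R * t by rewrite mulr_ge0.
apply: le_trans IHk; rewrite exprSr -mulrA ler_wpM2l // -natr1.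
nra.
Qed.

(** The terms linear in y cancel.  With E and O the sum and the difference of the
    two powers, O <= m y E, so the next step multiplies E by at most
    1 + m y^2 <= 1 + 2 m d <= (1 - d)^(-2 m). *)
Lemma even_part_le y d m : 0 <= y <= 1 -> 0 <= d <= 1 -> y ^+ 2 <= 2 * d ->
  ((1 + y) ^+ m + (1 - y) ^+ m) * (1 - d) ^+ (m * m.-1) <= 2.
Proof.
move=> /andP[y0 y1] /andP[d0 d1] yd.
pose E k := (1 + y) ^+ k + (1 - y) ^+ k; pose O k := (1 + y) ^+ k - (1 - y) ^+ k.
have E0 k : 0 <= E k by rewrite addr_ge0 // exprn_ge0; lra.
have O0 k : 0 <= O k by rewrite subr_ge0 lerXn2r ?nnegrE; lra.
have ES k : E k.+1 = E k + y * O k by rewrite /E /O !exprS; ring.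
have OS k : O k.+1 = O k + y * E k by rewrite /E /O !exprS; ring.
have OE k : O k <= k%:R * y * E k.
  elim: k => [|k IHk]; first by rewrite /O !expr0 subrr !mul0r.
  rewrite OS; apply: (@le_trans _ _ (k.+1%:R * y * E k)).
    by rewrite -natr1; lra.
  by rewrite ler_wpM2l ?mulr_ge0 // ES lerDl mulr_ge0.
rewrite -/(E m); elim: m => [|m IHm]; first by rewrite /E !expr0 mulr1; lra.
have -> : (m.+1 * m.+1.-1 = m * m.-1 + 2 * m)%N by case: m {IHm} => //= m; lia.
have le1 : E m.+1 <= (1 + (2 * m)%:R * d) * E m.
  rewrite ES natrM.
  have h1 : y * O m <= y * (m%:R * y * E m) by rewrite ler_wpM2l.
  have h2 : m%:R * E m * y ^+ 2 <= m%:R * E m * (2 * d) by rewrite ler_wpM2l ?mulr_ge0.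
  by rewrite -subr_ge0 in h1; rewrite -subr_ge0 in h2; rewrite -subr_ge0; nra.
have D1 k : 0 <= (1 - d) ^+ k by rewrite exprn_ge0 // subr_ge0.
have d01 : 0 <= d <= 1 by rewrite d0.
have B := bernoulli_inv (2 * m) d01.
rewrite exprD mulrA.
apply: (@le_trans _ _ ((1 + (2 * m)%:R * d) * E m * (1 - d) ^+ (m * m.-1) * (1 - d) ^+ (2 * m))).
  by rewrite ler_wpM2r // ler_wpM2r.
have -> : (1 + (2 * m)%:R * d) * E m * (1 - d) ^+ (m * m.-1) * (1 - d) ^+ (2 * m) =
  E m * (1 - d) ^+ (m * m.-1) * ((1 - d) ^+ (2 * m) * (1 + (2 * m)%:R * d)) by ring.
apply: le_trans IHm; rewrite -[leRHS]mulr1 ler_wpM2l // mulr_ge0 //.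
Qed.

Lemma expr_ord (c : R) k : c ^+ k = \prod_(i < k) c.
Proof. by rewrite prodr_const card_ord. Qed.

(** The number of ordered x-matchings of the balanced complete bipartite graph on
    n vertices, up to rounding. *)
Definition turan_matchings (n : R) x : R := \prod_(i < x) ((n - 2 * i%:R) ^+ 2 / 4).

Lemma turan_matchings_ge0 n x : 0 <= turan_matchings n x.
Proof. by apply: prodr_ge0 => i _; rewrite divr_ge0 // sqr_ge0. Qed.

Lemma turan_matchings_le (n : R) x : (0 < x)%N -> 8 * x%:R ^+ 2 <= n ->
  (n ^+ 2 / 4) ^+ x <= 2 * turan_matchings n x.
Proof.
move=> x0 xn; have x1 : 1 <= x%:R :> R by rewrite ler1n.
have n0 : 0 < n by nra.
have t0 : 0 <= 2 * x%:R / n <= 1.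
  apply/andP; split; first by rewrite divr_ge0 ?mulr_ge0 // ltW.
  by rewrite ler_pdivrMr //; nra.
have := bernoulli_sub (2 * x) t0.
have h : (2 * x)%:R * (2 * x%:R / n) <= 1 / 2 :> R.
  rewrite natrM mulrA ler_pdivrMr //; lra.
move=> B; have {B}B : 1 / 2 <= (1 - 2 * x%:R / n) ^+ (2 * x) by apply: le_trans B; lra.
have : (n ^+ 2 / 4) ^+ x * (1 - 2 * x%:R / n) ^+ (2 * x) <= turan_matchings n x.
  rewrite exprM -exprMn (expr_ord _ x).
  apply: ler_prod => i _; rewrite mulr_ge0 ?sqr_ge0 ?divr_ge0 ?sqr_ge0 //=.
  have -> : n ^+ 2 / 4 * (1 - 2 * x%:R / n) ^+ 2 = (n - 2 * x%:R) ^+ 2 / 4.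
    by field; rewrite gt_eqF.
  rewrite ler_pM2r ?invr_gt0 // lerXn2r ?nnegrE //;
    have : i%:R <= x%:R :> R by rewrite ler_nat ltnW.
  - by nra.
  - by nra.
  by lra.
have : 0 <= (n ^+ 2 / 4) ^+ x by rewrite exprn_ge0 // divr_ge0 // sqr_ge0.
nra.
Qed.

(** Each further edge keeps a factor 1 - d, where d = g / n^2; the slacks
    contribute an error of relative order d / n only. *)
Lemma matchings_recursion (n g e x : nat) (mo X : nat -> nat) :
  (2 * x <= n)%N -> (0 < n)%N -> (g <= n ^ 2)%N -> (4 * e <= n ^ 2)%N -> (mo 0 <= 1)%N ->
  (forall k, 4 * mo k.+1 + g * mo k <= (n - 2 * k) ^ 2 * mo k + 4 * X k)%N ->
  (forall k, n * X k <= k * g * e ^ k)%N ->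
  (mo x)%:R <= turan_matchings n%:R x * (1 - g%:R / n%:R ^+ 2) ^+ x +
    (2 * x ^ 2)%:R * (g%:R / n%:R ^+ 2) / n%:R * (n%:R ^+ 2 / 4) ^+ x :> R.
Proof.
move=> xn n0 gn en m0 hS hX.
set d := g%:R / n%:R ^+ 2; set N : R := n%:R.
have N0 : 0 < N by rewrite ltr0n.
have gd : g%:R = d * N ^+ 2 by rewrite /d; field; rewrite gt_eqF.
have N20 : 0 < N ^+ 2 by rewrite exprn_gt0.
have d0 : 0 <= d by rewrite divr_ge0 // ltW.
have d1 : d <= 1 by rewrite ler_pdivrMr // mul1r -natrX ler_nat.
have eN : e%:R <= N ^+ 2 / 4 by rewrite ler_pdivlMr // -natrX -natrM ler_nat mulnC.
suff W k : (k <= x)%N -> (mo k)%:R <= turan_matchings N k * (1 - d) ^+ k +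
    (2 * k ^ 2)%:R * d / N * (N ^+ 2 / 4) ^+ k by apply: W.
elim: k => [_|k IHk kx].
  rewrite /turan_matchings big_ord0 !expr0 mul1r muln0 !mul0r addr0.
  by rewrite lern1.
have {}IHk := IHk (ltnW kx).
have kn : (2 * k <= n)%N by lia.
have h1 := hS k; rewrite -(ler_nat R) !(natrX, natrD, natrM) natrB // natrM -/N gd in h1.
have h2 := hX k; rewrite -(ler_nat R) !(natrX, natrM) -/N gd in h2.
set M := (mo k)%:R in IHk h1; set M1 := (mo k.+1)%:R in h1 *.
set Xk := (X k)%:R in h1 h2.
set q := (N - 2 * k%:R) ^+ 2 / 4.
set A := (N ^+ 2 / 4) ^+ k in IHk.
have A0 : 0 <= A by rewrite exprn_ge0 // divr_ge0 // ltW.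
have kN : 0 <= N - 2 * k%:R by rewrite subr_ge0 -natrM ler_nat.
have qN : q <= N ^+ 2 / 4.
  rewrite ler_pM2r ?invr_gt0 // lerXn2r ?nnegrE ?(ltW N0) // lerBlDr lerDl.
  by rewrite mulr_ge0.
have q0 : 0 <= q by rewrite divr_ge0 ?sqr_ge0.
have M0 : 0 <= M by rewrite /M.
have h3 : M1 <= M * (q * (1 - d)) + Xk.
  have -> : q * (1 - d) = ((N - 2 * k%:R) ^+ 2 - d * (q * 4)) / 4 by rewrite /q; field.
  have : d * (q * 4) * M <= d * N ^+ 2 * M.
    by rewrite ler_wpM2r // ler_wpM2l //; lra.
  lra.
have h4 : Xk <= 4 * k%:R * d / N * (N ^+ 2 / 4 * A).
  have e4 : e%:R ^+ k <= A by rewrite lerXn2r ?nnegrE // divr_ge0 // ltW.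
  rewrite -(ler_pM2l N0); apply: le_trans h2 _.
  have -> : N * (4 * k%:R * d / N * (N ^+ 2 / 4 * A)) = k%:R * (d * N ^+ 2) * A.
    by field; rewrite gt_eqF.
  by rewrite ler_wpM2l // mulr_ge0 // mulr_ge0 // sqr_ge0.
have q1 : 0 <= q * (1 - d) by rewrite mulr_ge0 // subr_ge0.
have q2 : q * (1 - d) <= N ^+ 2 / 4.
  by apply: le_trans qN; rewrite -[leRHS]mulr1 ler_wpM2l //; lra.
apply: le_trans h3 _.
have h5 : M * (q * (1 - d)) <= (turan_matchings N k * (1 - d) ^+ k +
  (2 * k ^ 2)%:R * d / N * A) * (q * (1 - d)).
  by rewrite ler_wpM2r.
have h6 : (2 * k ^ 2)%:R * d / N * A * (q * (1 - d)) <=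
  (2 * k ^ 2)%:R * d / N * A * (N ^+ 2 / 4).
  by rewrite ler_wpM2l // !mulr_ge0 // invr_ge0 ltW.
have -> : turan_matchings N k.+1 = turan_matchings N k * q.
  by rewrite /turan_matchings big_ord_recr.
have h7 : (2 * k.+1 ^ 2)%:R = (2 * k ^ 2)%:R + 4 * k%:R + 2 :> R.
  by rewrite !(natrX, natrM) -natr1; ring.
have h8 : 0 <= 2 * d / N * A * (N ^+ 2 / 4).
  by rewrite !mulr_ge0 ?invr_ge0 // ltW.
rewrite h7 [(1 - d) ^+ k.+1]exprSr [(N ^+ 2 / 4) ^+ k.+1]exprSr -/A.
have -> : turan_matchings N k * q * ((1 - d) ^+ k * (1 - d)) +
  ((2 * k ^ 2)%:R + 4 * k%:R + 2) * d / N * (A * (N ^+ 2 / 4)) =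
  turan_matchings N k * (1 - d) ^+ k * (q * (1 - d)) +
  (2 * k ^ 2)%:R * d / N * A * (N ^+ 2 / 4) + 4 * k%:R * d / N * (N ^+ 2 / 4 * A) +
  2 * d / N * A * (N ^+ 2 / 4) by ring.
move: h5; rewrite mulrDl; lra.
Qed.

(** Rounding n / 2 changes each factor by a relative amount of order 1 / n^2. *)
Lemma ffact_turan (n x : nat) : (0 < x)%N -> (8 * x < n)%N ->
  turan_matchings n%:R x * (1 - (2 * n%:R)^-1) <= (n./2 ^_ x * (n - n./2) ^_ x)%:R :> R.
Proof.
move=> x0 xn; set N : R := n%:R; have N0 : 0 < N by rewrite ltr0n; lia.
have t0 : 0 <= 4 / N ^+ 2 <= 1.
  have : 4 <= N ^+ 2 by rewrite -natrX ler_nat; nia.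
  by move=> h; rewrite divr_ge0 ?sqr_ge0 //= ler_pdivrMr ?exprn_gt0 // mul1r.
have := bernoulli_sub x t0 => B.
have h : x%:R * (4 / N ^+ 2) <= (2 * N)^-1.
  rewrite mulrA ler_pdivrMr ?exprn_gt0 //.
  have -> : (2 * N)^-1 * N ^+ 2 = N / 2 by field; rewrite gt_eqF.
  have : 8 * x%:R <= N by rewrite -natrM ler_nat ltnW.
  lra.
apply: (@le_trans _ _ (turan_matchings N x * (1 - 4 / N ^+ 2) ^+ x)).
  by rewrite ler_wpM2l ?turan_matchings_ge0 //; lra.
rewrite !ffact_prod -big_split /= natr_prod (expr_ord _ x) -big_split /=.
apply: ler_prod => i _; apply/andP; split.
  by rewrite mulr_ge0 ?divr_ge0 ?sqr_ge0 // subr_ge0; case/andP: t0.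
have ix := ltn_ord i.
have iE : N - 2 * i%:R = (n - 2 * i)%:R by rewrite natrB ?natrM //; lia.
have h1 : ((n - 2 * i) ^ 2 <= 4 * ((n./2 - i) * (n - n./2 - i)) + 1)%N.
  rewrite -mulnn; have := odd_double_half n; case: (odd n) => /=; nia.
have h2 : (n ^ 2 <= 4 * (n - 2 * i) ^ 2)%N.
  by have h0 : (n <= 2 * (n - 2 * i))%N; [lia|rewrite -!mulnn; nia].
rewrite -(ler_nat R) !(natrX, natrD, natrM) -iE -/N in h1;
  rewrite -(ler_nat R) !(natrX, natrM) -iE -/N in h2.
have h3 : N ^+ 2 / N ^+ 2 = 1 by rewrite divff // gt_eqF // exprn_gt0.
have h4 : 1 <= (N - 2 * i%:R) ^+ 2 * (4 / N ^+ 2).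
  by rewrite mulrA ler_pdivlMr ?exprn_gt0 // mul1r mulrC.
lra.
Qed.

(** Per vertex the loss is a factor 1 - (2 u + 1) / (n - 2 x), and 2 u + 2 factors
    1 - 1 / n outweigh it for large n. *)
Lemma half_pow_ge (n x u : nat) : 
  (2 * x * (2 * u + 2) + (2 * u + 1) * (2 * u + 2) < n)%N ->
  ((n%:R - 2 * x%:R) / 2) ^+ u * (1 - n%:R^-1) ^+ (2 * u ^ 2 + 2 * u) <=
  ((n./2 - x - u) ^ u)%:R :> R.
Proof.
move=> hn; set N : R := n%:R; have N0 : 0 < N by rewrite ltr0n; lia.
have -> : (2 * u ^ 2 + 2 * u = (2 * u + 2) * u)%N by lia.
rewrite exprM -exprMn natrX; apply: lerXn2r; rewrite ?nnegrE //.
  rewrite mulr_ge0 ?exprn_ge0 ?divr_ge0 //.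
    by rewrite subr_ge0 -natrM ler_nat; nia.
  by rewrite subr_ge0 invf_le1 // ler1n; lia.
set k := (2 * u + 2)%N.
have t0 : 0 <= N^-1 <= 1 by rewrite invr_ge0 ltW //= invf_le1 // ler1n; lia.
have := bernoulli_inv k t0; set B := (1 - N^-1) ^+ k => hB.
have hB' : B <= N / (N + k%:R).
  rewrite ler_pdivlMr; last by rewrite ltr_wpDr.
  have -> : B * (N + k%:R) = N * (B * (1 + k%:R * N^-1)) by field; rewrite gt_eqF.
  by rewrite -[leRHS]mulr1 ler_pM2l.
have n'0 : 0 <= N - 2 * x%:R by rewrite subr_ge0 -natrM ler_nat; nia.
apply: (@le_trans _ _ ((N - 2 * x%:R) / 2 * (N / (N + k%:R)))).
  by rewrite ler_wpM2l // divr_ge0.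
have h1 : N - 2 * x%:R - (2 * u%:R + 1) <= 2 * (n./2 - x - u)%:R.
  have : (n <= 2 * (n./2 - x - u) + (2 * x + (2 * u +
    1)))%N by have := odd_double_half n; case: odd; nia.
  by rewrite -(ler_nat R) !(natrD, natrM) -/N; lra.
have h2 : (N - 2 * x%:R) * N <= (N - 2 * x%:R - (2 * u%:R + 1)) * (N + k%:R).
  have : (2 * u%:R + 1) * (N + k%:R) <= (N - 2 * x%:R) * k%:R.
    have : ((2 * u + 1) * (n + k) + 2 * x * k <= n * k)%N by rewrite /k; nia.
    by rewrite -(ler_nat R) !(natrD, natrM) -/N; lra.
  lra.
have Nk : 0 < N + k%:R by rewrite ltr_wpDr.
rewrite mulrA ler_pdivrMr //; nra.
Qed.

(** The exponents balance with one factor 1 - d <= 1 - 1 / N to spare, which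
    covers both error terms as these are at most d / 4 and 1 / (2 N). *)
Lemma loss_beats_gain (N d K : R) (x u : nat) :
  (4 * u ^ 2 + 1 <= x)%N -> 0 < N -> N^-1 <= d -> d <= 1 -> 0 <= K -> 4 * K <= N ->
  (4 * u ^ 2 + 4 * u)%:R <= N ->
  (1 - d) ^+ (x - u * u.-1) + K * d / N <=
  (1 - (2 * N)^-1) * (1 - N^-1) ^+ (2 * u ^ 2 + 2 * u).
Proof.
move=> ux N0 Nd d1 K0 KN uN.
have Ni : 0 < N^-1 by rewrite invr_gt0.
set a := (2 * u ^ 2 + 2 * u)%N; set p := (1 - N^-1) ^+ a.
have d0 : 0 <= d by apply: le_trans Nd; rewrite ltW.
have aE : (x - u * u.-1 = a.+1 + (x - u * u.-1 - a.+1))%N.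
  by rewrite subnKC // /a; move: ux; rewrite -!mulnn; case: u {uN a p} => [|v] /=; nia.
have p2 : 1 / 2 <= p.
  have t0 : 0 <= N^-1 <= 1 by rewrite ltW //= (le_trans Nd).
  apply: le_trans (bernoulli_sub a t0).
  have : a%:R * N^-1 <= 1 / 2.
    rewrite ler_pdivrMr //; have : (4 * u ^ 2 + 4 * u = 2 * a)%N by rewrite /a; lia.
    move=> E; move: uN; rewrite E natrM; lra.
  lra.
have h1 : (1 - d) ^+ (x - u * u.-1) <= p * (1 - d).
  rewrite aE exprD -[leRHS]mulr1; apply: ler_pM.
  - by rewrite exprn_ge0 // subr_ge0.
  - by rewrite exprn_ge0 // subr_ge0.
  - by rewrite exprSr ler_wpM2r ?subr_ge0 // lerXn2r ?nnegrE ?subr_ge0 ?(le_trans Nd) // lerB.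
  - by rewrite exprn_ile1 ?subr_ge0 // gerBl.
have h2 : K * d / N <= p * (d / 2).
  have : K / N <= 1 / 4 by rewrite ler_pdivrMr //; lra.
  move=> h; have -> : K * d / N = K / N * d by ring.
  have : K / N * d <= 1 / 4 * d by rewrite ler_wpM2r.
  have : 1 / 2 * (d / 2) <= p * (d / 2) by rewrite ler_wpM2r // divr_ge0.
  lra.
have -> : (2 * N)^-1 = N^-1 / 2 by field; rewrite gt_eqF.
have : p * (1 - d / 2) <= p * (1 - N^-1 / 2).
  by rewrite ler_wpM2l //; lra.
lra.
Qed.

End Numerics.

Section Comparison.
Local Open Scope ring_scope.

(** The relative deviation of [D] from half of [n - 2 * x] has square at most
    [2 * g / n ^ 2].  If [D] exceeds the rounded half it is at most the maximum
    degree [De], whose deviation the third hypothesis controls; the shift by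
    [2 * x] disappears in the factor 2 for large [n]. *)
Lemma spread_le (n x De D D' g : nat) :
  (80 * x ^ 2 + 16 * x < n)%N -> (n <= g)%N ->
  ((2 * De) ^ 2 + n ^ 2 <= g + 4 * (De * n))%N ->
  (D + D' = n - 2 * x)%N -> (D' <= D)%N ->
  D = minn (n - 2 * x) (maxn De (uphalf (n - 2 * x))) ->
  ((D - D') ^ 2 * n ^ 2 <= 2 * g * (n - 2 * x) ^ 2)%N.
Proof.
move=> nx ng hDe DD D'D ED.
set n' := (n - 2 * x)%N in DD ED *.
have n'E : (n = n' + 2 * x)%N by rewrite /n'; lia.
have h34 : (3 * n ^ 2 <= 4 * n' ^ 2)%N.
  have h78 : (7 * n <= 8 * n')%N by lia.
  have : ((7 * n) * (7 * n) <= (8 * n') * (8 * n'))%N by rewrite leq_mul.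
  by rewrite -!mulnn; lia.
suff h : ((D - D') ^ 2 * 2 <= 3 * g)%N.
  have : ((D - D') ^ 2 * 2 * (3 * n ^ 2) <= 3 * g * (4 * n' ^ 2))%N by rewrite leq_mul.
  lia.
have [le|lt] := leqP De (uphalf n').
  have : (D - D' <= 1)%N by move: ED; rewrite (maxn_idPr le); lia.
  by case: (D - D')%N => [|[|]] // _; lia.
have DDe : (D <= De)%N by rewrite ED (maxn_idPl (ltnW lt)) geq_minr.
have DDz : (D - D' + n <= 2 * De + 2 * x)%N by lia.
have x2 : (80 * (x * x) <= g)%N by move: nx; rewrite -mulnn; lia.
have key (s z y h : int) : 0 <= s -> s <= z + 2 * y -> z * z <= h -> 80 * (y * y) <= h ->
  s * s * 2 <= 3 * h.
  move=> s0 sz zh yh.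
  have h0 : 0 <= (z - 8 * y) * (z - 8 * y) by rewrite -expr2 sqr_ge0.
  have h1 : s * s <= (z + 2 * y) * (z + 2 * y) by rewrite ler_pM.
  have E0 : (z - 8 * y) * (z - 8 * y) = z * z - 16 * (z * y) + 64 * (y * y) by ring.
  have E1 : (z + 2 * y) * (z + 2 * y) = z * z + 4 * (z * y) + 4 * (y * y) by ring.
  by rewrite E0 in h0; rewrite E1 in h1; lia.
have := key (D - D')%N%:Z (2 * De%:Z - n%:Z) x%:Z g%:Z.
have E : (2 * De%:Z - n%:Z) * (2 * De%:Z - n%:Z) =
  ((2 * De) ^ 2 + n ^ 2)%N%:Z - 4 * (De * n)%N%:Z.
  by rewrite -!mulnn !PoszD !PoszM; ring.
rewrite E => /(_ _ _ _ _) h; rewrite -mulnn;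
  suff : (D - D')%N%:Z * (D - D')%N%:Z * 2 <= 3 * g%:Z by lia.
by apply: h; lia.
Qed.

(** In the application [g] is the gap of [G], [e] its number of edges, [De] its
    maximum degree, [mo k] the number of its ordered [k]-matchings and [X k] the
    sum of their slacks. *)
Lemma count_comparison (x u : nat) : (4 * u ^ 2 + 1 <= x)%N ->
  exists n0 : nat, forall (n g e De D D' : nat) (mo X : nat -> nat),
  (n0 <= n)%N -> (n <= g)%N -> (g <= n ^ 2)%N -> (4 * e <= n ^ 2)%N -> (mo 0 <= 1)%N ->
  (forall k, 4 * mo k.+1 + g * mo k <= (n - 2 * k) ^ 2 * mo k + 4 * X k)%N ->
  (forall k, n * X k <= k * g * e ^ k)%N ->
  ((2 * De) ^ 2 + n ^ 2 <= g + 4 * (De * n))%N ->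
  (D + D' = n - 2 * x)%N -> (D' <= D)%N ->
  D = minn (n - 2 * x) (maxn De (uphalf (n - 2 * x))) ->
  (mo x * (D ^ u + D' ^ u) <=
     2 * (n./2 ^_ x * (n - n./2) ^_ x * (n./2 - x - u) ^ u))%N.
Proof.
move=> ux; have x0 : (0 < x)%N by lia.
pose K := (2 ^ u.+1 * (2 * x ^ 2))%N.
(* K / 2 ^ u.+1 is the constant of the error term of [matchings_recursion], and
   2 ^ u.+1 bounds (1 + y) ^ u + (1 - y) ^ u. *)
exists (80 * x ^ 2 + 16 * x + (2 * x * (2 * u + 2) + (2 * u + 1) * (2 * u + 2)) +
        (4 * u ^ 2 + 4 * u) + 4 * K + 1)%N.
move=> n g e De D D' mo X nn ng gn en m0 hS hX hDe DD D'D ED.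
have [n1 n2 n3 n4] : [/\ 80 * x ^ 2 + 16 * x < n,
    2 * x * (2 * u + 2) + (2 * u + 1) * (2 * u + 2) < n,
    4 * u ^ 2 + 4 * u <= n & 4 * K <= n]%N.
  by move: nn; clear; split; lia.
have n0 : (0 < n)%N by apply: leq_ltn_trans n1.
have x2 : (x <= x ^ 2)%N by rewrite -mulnn leq_pmulr.
have xn : (16 * x < n)%N by move: n1; clear; lia.
have xn2 : (8 * x ^ 2 <= n)%N by move: n1; clear; lia.
have xn1 : (2 * x < n)%N by move: xn; clear; lia.
pose R := rat; pose N : R := n%:R; have N0 : 0 < N by rewrite ltr0n.
have N20 : 0 < N ^+ 2 by rewrite exprn_gt0.
pose d : R := g%:R / N ^+ 2.
have gd : g%:R = d * N ^+ 2 by rewrite /d; field; rewrite gt_eqF.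
have d1 : d <= 1 by rewrite ler_pdivrMr // mul1r -natrX ler_nat.
have dN : N^-1 <= d.
  rewrite ler_pdivlMr //; have -> : N^-1 * N ^+ 2 = N by field; rewrite gt_eqF.
  by rewrite ler_nat.
have d0 : 0 <= d by apply: le_trans dN; rewrite invr_ge0 ltW.
have h1 := matchings_recursion R (ltnW xn1) n0 gn en m0 hS hX; rewrite -/N -/d in h1.
have h2 : (N ^+ 2 / 4) ^+ x <= 2 * turan_matchings N x.
  by apply: turan_matchings_le => //; rewrite -natrX -natrM ler_nat.
have h3 : turan_matchings N x * (1 - (2 * N)^-1) <= (n./2 ^_ x * (n - n./2) ^_ x)%:R.
  by apply: ffact_turan => //; move: xn; clear; lia.
have h4 : ((N - 2 * x%:R) / 2) ^+ u * (1 - N^-1) ^+ (2 * u ^ 2 + 2 * u) <=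
    ((n./2 - x - u) ^ u)%:R by apply: half_pow_ge.
have h5 : ((D - D') ^ 2 * n ^ 2 <= 2 * g * (n - 2 * x) ^ 2)%N.
  by apply: (spread_le (De := De)).
have h6 : (1 - d) ^+ (x - u * u.-1) + K%:R * d / N <=
   (1 - (2 * N)^-1) * (1 - N^-1) ^+ (2 * u ^ 2 + 2 * u).
  by apply: loss_beats_gain; rewrite // -?natrM ler_nat.
pose n' : R := N - 2 * x%:R.
have n'E : n' = (n - 2 * x)%:R by rewrite natrB ?natrM // ltnW.
have n'0 : 0 < n' by rewrite n'E ltr0n subn_gt0.
pose y := (D - D')%:R / n'.
have DDR : D%:R + D'%:R = n' by rewrite n'E -DD natrD.
have DD'R : D%:R - D'%:R = y * n' by rewrite /y natrB //; field; rewrite gt_eqF.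
have DE : D%:R = n' / 2 * (1 + y) by lra.
have D'E : D'%:R = n' / 2 * (1 - y) by lra.
have y0 : 0 <= y by rewrite divr_ge0 // ltW.
have y1 : y <= 1 by rewrite ler_pdivrMr // mul1r -DDR natrB // lerD2l;
  have : 0 <= D'%:R :> R by []; lra.
have yd : y ^+ 2 <= 2 * d.
  rewrite -(ler_nat R) !(natrX, natrM) natrB // DD'R -n'E gd -/N in h5.
  have E : (y * n') ^+ 2 * N ^+ 2 = y ^+ 2 * (n' ^+ 2 * N ^+ 2) by ring.
  have E2 : 2 * (d * N ^+ 2) * n' ^+ 2 = 2 * d * (n' ^+ 2 * N ^+ 2) by ring.
  by rewrite E E2 ler_pM2r // mulr_gt0 // exprn_gt0 in h5.
pose Q := (n' / 2) ^+ u.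
have Q0 : 0 <= Q by rewrite exprn_ge0 // divr_ge0 // ltW.
pose S := (1 + y) ^+ u + (1 - y) ^+ u.
have SE : (D ^ u + D' ^ u)%:R = Q * S.
  by rewrite natrD !natrX DE D'E 2!(exprMn u (n' / 2)) -mulrDr.
have h7 : S * (1 - d) ^+ (u * u.-1) <= 2 by apply: even_part_le; rewrite ?y0 ?d0.
have S0 : 0 <= S by rewrite addr_ge0 // exprn_ge0 //; lra.
have h8 : S <= 2 * 2 ^+ u.
  have : (1 + y) ^+ u <= 2 ^+ u by apply: lerXn2r; rewrite ?nnegrE; move: y0 y1; clear; lra.
  have : (1 - y) ^+ u <= 2 ^+ u by apply: lerXn2r; rewrite ?nnegrE; move: y0 y1; clear; lra.
  by move=> a b; apply: le_trans (lerD b a) _; rewrite (_ : 2 * _ = 2 ^+ u + 2 ^+ u) //;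
    ring.
pose T := turan_matchings N x; have T0 : 0 <= T by apply: turan_matchings_ge0.
rewrite -(ler_nat R) (natrM _ (mo x)) SE (natrM _ 2) (natrM _ (_ * _)).
set M := (mo x)%:R in h1 *; set F := (_ * _)%:R in h3 *; set W := ((_ - _) ^ _)%:R in h4 *.
have ex : (x = x - u * u.-1 + u * u.-1)%N.
  by rewrite subnK //; move: ux; rewrite -mulnn; clear; case: u => [|v] /=; nia.
have s1 : T * (1 - d) ^+ x * S <= 2 * T * (1 - d) ^+ (x - u * u.-1).
  rewrite [in X in _ ^+ X]ex exprD.
  have D0 k : 0 <= (1 - d) ^+ k by rewrite exprn_ge0 // subr_ge0.
  have -> : T * ((1 - d) ^+ (x - u * u.-1) * (1 - d) ^+ (u * u.-1)) * S =
     T * (1 - d) ^+ (x - u * u.-1) * (S * (1 - d) ^+ (u * u.-1)) by ring.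
  have -> : 2 * T * (1 - d) ^+ (x - u * u.-1) = T * (1 - d) ^+ (x - u * u.-1) * 2 by ring.
  by rewrite ler_wpM2l // mulr_ge0.
have c0 : 0 <= (2 * x ^ 2)%:R * d / N by rewrite !mulr_ge0 // invr_ge0 ltW.
have s2 : (2 * x ^ 2)%:R * d / N * (N ^+ 2 / 4) ^+ x * S <= 2 * T * (K%:R * d / N).
  have -> : 2 * T * (K%:R * d / N) = (2 * x ^ 2)%:R * d / N * (2 * T) * (2 * 2 ^+ u).
    by rewrite /K natrM natrX exprS; ring.
  apply: ler_pM => //; first by rewrite mulr_ge0 // exprn_ge0 // divr_ge0 // ltW.
  by rewrite ler_wpM2l.
have s3 : M * S <= 2 * T * ((1 - d) ^+ (x - u * u.-1) + K%:R * d / N).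
  apply: (@le_trans _ _ ((T * (1 - d) ^+ x +
    (2 * x ^ 2)%:R * d / N * (N ^+ 2 / 4) ^+ x) * S)).
    by rewrite ler_wpM2r.
  by rewrite mulrDl [leRHS]mulrDr lerD.
have s4 : M * S <= 2 * T * ((1 - (2 * N)^-1) * (1 - N^-1) ^+ (2 * u ^ 2 + 2 * u)).
  by apply: le_trans s3 _; rewrite ler_wpM2l // mulr_ge0.
have N1 : 0 <= 1 - (2 * N)^-1.
  rewrite subr_ge0 invf_le1 ?mulr_gt0 //.
  by apply: (@le_trans _ _ N); rewrite ?ler1n // ler_peMl ?ler1n // ltW.
have N2 : 0 <= 1 - N^-1 by rewrite subr_ge0 invf_le1 // ler1n.
have s5 : T * (1 - (2 * N)^-1) * (Q * (1 - N^-1) ^+ (2 * u ^ 2 + 2 * u)) <= F * W.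
  by apply: ler_pM => //; apply: mulr_ge0 => //; apply: exprn_ge0.
have -> : M * (Q * S) = Q * (M * S) by ring.
apply: (@le_trans _ _ (Q * (2 * T * ((1 - (2 * N)^-1) * (1 - N^-1) ^+ (2 * u ^ 2 +
  2 * u))))).
  by rewrite ler_wpM2l.
have -> : Q * (2 * T * ((1 - (2 * N)^-1) * (1 - N^-1) ^+ (2 * u ^ 2 + 2 * u))) =
  2 * (T * (1 - (2 * N)^-1) * (Q * (1 - N^-1) ^+ (2 * u ^ 2 + 2 * u))) by ring.
by rewrite ler_wpM2l.
Qed.

End Comparison.

(** * The theorem *)

Definition is_pairing (H : sgraph) (s : seq (H * H)) : bool :=
  all (fun e => adj e.1 e.2) s && uniq (ends s).

Lemma card_edge (H : sgraph) (e : {set H}) : e \in edges H -> #|e| = 2.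
Proof.
case/imsetP => -[a b] /[!inE] /= ab ->; rewrite cards2.
by case: eqP => // E; rewrite E adj_irr in ab.
Qed.

Lemma card_cover_matching (H : sgraph) (M : {set {set H}}) :
  matching M -> #|cover M| = 2 * #|M|.
Proof.
case=> /subsetP ME /eqP <-; rewrite mulnC -sum_nat_const.
by apply: eq_bigr => e /ME /card_edge.
Qed.

(** The pairs have as many ends as [M] covers vertices, so no end is repeated. *)
Lemma matching_pairing (H : sgraph) (M : {set {set H}}) :
  matching M -> exists2 s : seq (H * H), is_pairing s & size s = #|M|.
Proof.
move=> mM; have cM := card_cover_matching mM; case: mM => /subsetP ME _.
have [s sA sE] : exists2 s : seq (H * H), all (fun e => adj e.1 e.2) s &
    [seq [set e.1; e.2] | e <- s] = enum M.
  have : {subset enum M <= edges H} by move=> e; rewrite mem_enum => /ME.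
  elim: (enum M) => [|e es IHs] sub; first by exists [::].
  have [|s sA <-] := IHs; first by move=> z zs; apply: sub; rewrite inE zs orbT.
  have /imsetP[p pA ->] := sub e (mem_head _ _).
  by exists (p :: s) => //=; rewrite sA andbT; rewrite inE in pA.
have sz : size s = #|M| by rewrite cardE -sE size_map.
exists s => //; rewrite /is_pairing sA /=; apply/card_uniqP.
rewrite size_ends sz -cM; apply: eq_card => v; rewrite /cover.
apply/mem_ends/bigcupP => [[e es ve]|[e eM ve]].
  exists [set e.1; e.2]; last by rewrite !inE.
  by rewrite -mem_enum -sE; apply: map_f.
move: eM ve; rewrite -mem_enum -sE => /mapP[e' es' ->].
by rewrite !inE => ve; exists e'.
Qed.

(** The uncovered vertices of a maximum matching are independent; at the same
    time there are no more of them than before. *)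
Lemma maximal_pairing (H : sgraph) (s : seq (H * H)) : is_pairing s ->
  exists2 k, size s <= k & exists P : k.-tuple (H * H), is_pairing P /\
    forall u v : H, adj u v -> (u \in ends P) || (v \in ends P).
Proof.
move=> sP.
pose Q k := [exists P : k.-tuple (H * H), is_pairing P].
have Qs : Q (size s) by apply/existsP; exists (in_tuple s).
have Qb k : Q k -> k <= #|H|.
  case/existsP => P /andP[_ /card_uniqP]; rewrite size_ends size_tuple => E.
  by have := max_card (mem (ends P)); rewrite E; lia.
case: (ex_maxnP (ex_intro (fun k => Q k) _ Qs) Qb) => k Qk kmax.
exists k; first exact: kmax.
case/existsP: Qk => P PP; exists P; split=> // u v uv.
apply/negPn/negP; rewrite negb_or => /andP[uP vP].
have : Q k.+1.
  apply/existsP; exists [tuple of (u, v) :: P]; case/andP: PP => PA PU.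
  rewrite /is_pairing /= uv PA /ends /= -/(ends P) PU inE negb_or uP vP !andbT.
  by apply/eqP => E; rewrite E adj_irr in uv.
by move=> /kmax; rewrite ltnn.
Qed.

Lemma colour_class_ge (H : sgraph) (k : nat) (P : k.-tuple (H * H)) (chi : {ffun H ->
  bool}) :
  is_pairing P -> chi \in proper_colourings H ->
  k <= #|[pred v | chi v]| /\ k <= #|[pred v | ~~ chi v]|.
Proof.
move=> /andP[/allP PA PU]; rewrite inE => /forallP hc.
have hc' u v : adj u v -> chi u != chi v by apply/implyP/(forallP (hc u)).
have key (F : pred H) : (forall u v, adj u v -> F u + F v = 1) -> k <= #|[pred v | F v]|.
  move=> hF.
  have -> : k = \sum_(v <- ends P) F v.
    rewrite sum_ends -{1}(size_tuple P) -sum1_size big_seq [RHS]big_seq.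
    by apply: eq_bigr => e /PA /hF.
  rewrite (big_uniq _ PU) /= -sum1_card big_mkcond [X in _ <= X]big_mkcond /=.
  by apply: leq_sum => v _; rewrite !inE; case: (v \in ends P); case: (F v).
by split; apply: key => u v /hc'; case: (chi u); case: (chi v).
Qed.

Lemma embeddings_bipartite_max (H G : sgraph) : 1 < #|G| -> bipartite G ->
  exists2 a, 0 < a < #|G| & #|embeddings H G| <= #|embeddings H (Kab a (#|G| - a))|.
Proof.
move=> n2 [A hA].
suff [A' hA' c] : exists2 A' : {set G},
    forall u v : G, adj u v -> (u \in A') != (v \in A') & 0 < #|A'| < #|G|.
  exists #|A'| => //; have := embeddings_bipartite H hA'.
  by have -> : #|~: A'| = #|G| - #|A'| by rewrite cardsCs setCK.
have [n0|A0] := boolP (0 < #|A| < #|G|); first by exists A.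
(* The given bipartition has an empty side, so there are no edges and any
   singleton does. *)
have noadj (u v : G) : adj u v = false.
  apply/negP => uv; move/negP: A0; apply; have := hA u v uv.
  have lt (z w : G) : z \in A -> w \notin A -> 0 < #|A| < #|G|.
    move=> zA wA; apply/andP; split; first by apply/card_gt0P; exists z.
    by rewrite -cardsT; apply/proper_card/properP; split; [apply: subsetT | exists w].
  case: (boolP (u \in A)) => uA; case: (boolP (v \in A)) => vA // _.
    exact: lt uA vA.
  exact: lt vA uA.
have /card_gt0P[g _] : 0 < #|G| by apply: ltn_trans n2.
by exists [set g]; [move=> u v; rewrite noadj | rewrite cards1].
Qed.

Theorem theorem3 (R : rcfType) (H : sgraph) (x : nat) :
  0 < x ->
  bipartite H ->
  (exists M : {set {set H}},
     [/\ matching M, #|M| = x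
       & ((#|~: cover M|%:R : R) <= 2^-1 * Num.sqrt (x%:R - 1))%R]) ->
  exists n1 : nat, forall n : nat, n1 <= n ->
    exists B : sgraph,
      [/\ #|B| = n, complete_bipartite B
        & forall G : sgraph, #|G| = n -> triangle_free G ->
            copies H G <= copies H B].
Proof.
move=> x0 Hbip [M [mM cM sqM]].
have ux : 4 * #|~: cover M| ^ 2 + 1 <= x.
  have x1 : (0 <= x%:R - 1 :> R)%R by rewrite subr_ge0 ler1n.
  rewrite -(ler_nat R) natrD natrM natrX -lerBrDr -(sqr_sqrtr x1).
  have -> : (4%:R * #|~: cover M|%:R ^+ 2 = (2%:R * #|~: cover M|%:R) ^+ 2 :> R)%R by ring.
  apply: lerXn2r; rewrite ?nnegrE ?mulr_ge0 ?sqrtr_ge0 //.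
  by rewrite -ler_pdivlMl.
have cC : #|~: cover M| = #|H| - 2 * x by rewrite cardsCs setCK (card_cover_matching mM) cM.
have [s sP sz] := matching_pairing mM.
have [k xk [P [PP Pmax]]] := maximal_pairing sP.
rewrite sz cM in xk; rewrite cC in ux.
pose u := #|H| - 2 * k.
have cH : #|H| = k + k + u.
  case/andP: PP => _ /card_uniqP; rewrite size_ends size_tuple => E.
  by have := max_card (mem (ends P)); rewrite E /u; lia.
have uk : 4 * u ^ 2 + 1 <= k.
  apply: leq_trans (xk); apply: leq_trans ux; rewrite leq_add2r leq_mul2l /= leq_sqr.
  by rewrite /u leq_sub2l // leq_mul2l xk orbT.
have [n0 Hn0] := count_comparison uk.
exists (n0 + 2) => n nn; have n2 : 1 < n by lia.
pose emb a := #|embeddings H (Kab a (n - a))|.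
have hh : 0 < n./2 < n by move: n2; clear; lia.
have hn : n./2 < n by case/andP: hh.
have pos0 : 0 < Ordinal hn by case/andP: hh.
case: (arg_maxnP (fun i : 'I_n => emb i) (P := fun i : 'I_n => 0 < i) pos0) => a a0 amax.
exists (Kab a (n - a)); split.
- by rewrite card_Kab subnKC // ltnW.
- by apply: Kab_complete; rewrite // subn_gt0.
move=> G cG tf; apply: copies_le.
have max b : 0 < b < n -> emb b <= emb a.
  by move=> /andP[b0 bn]; apply: (amax (Ordinal bn)).
have [/existsP[A /forallP hA]|nb] := boolP [exists A : {set G},
    [forall u, [forall v, adj u v ==> ((u \in A) != (v \in A))]]].
  have bG : bipartite G by exists A => v w; apply/implyP/(forallP (hA v)).
  have G2 : 1 < #|G| by rewrite cG.
  have [b b0 le] := embeddings_bipartite_max H G2 bG.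
  by rewrite cG in b0 le; apply: leq_trans le (max b b0).
have {}nb : ~ bipartite G.
  case=> A hA; move/negP: nb; apply; apply/existsP; exists A.
  by apply/forallP => v; apply/forallP => w; apply/implyP/hA.
have /card_gt0P[g0 _] : 0 < #|G| by rewrite cG ltnW.
have [v vmax] : exists v : G, forall w : G, degree w <= degree v.
  by case: (@arg_maxnP G g0 xpredT (fun v : G => degree v) isT) => v _ h; exists v => w;
    apply: h.
(* Rounding up makes D' the smaller part even if all degrees are small. *)
pose D := minn (n - 2 * k) (maxn (degree v) (uphalf (n - 2 * k))).
pose D' := n - 2 * k - D.
have DD' : D + D' = n - 2 * k by rewrite subnKC // geq_minl.
have D'D : D' <= D by rewrite /D' /D; clear; lia.
have gE := gapE tf; rewrite cG in gE.
have le1 : #|ordered_matchings G k| * (D ^ u + D' ^ u) <=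
    2 * (n./2 ^_ k * (n - n./2) ^_ k * (n./2 - k - u) ^ u).
  apply: (Hn0 n (gap G) (num_edges G) (degree v) D D' (fun i => #|ordered_matchings G i|)
     (fun i => \sum_(s in ordered_matchings G i) total_slack s)) => //.
  - by apply: leq_trans nn; apply: leq_addr.
  - by rewrite -cG; apply: gap_ge.
  - by rewrite -gE leq_addr.
  - by rewrite -gE -(num_edgesE G) mulnA leq_addl.
  - by apply: leq_trans (card_ordered_matchings_le G 0) _; rewrite expn0.
  - by move=> i; rewrite -cG; apply: ordered_matchings_step.
  - by move=> i; rewrite -cG; apply: sum_total_slack_gap.
  - by have := gap_maxdeg tf vmax; rewrite cG.
have le2 : 2 * #|embeddings H G| <=
  #|ordered_matchings G k| * (#|proper_colourings H| * (D ^ u + D' ^ u)).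
  case/andP: (PP) => PA PU.
  apply: (embeddings_le_matchings tf PA PU Pmax Hbip g0); rewrite ?cG // => g.
  by rewrite /D leq_min geq_minl leq_max (leq_trans (geq_minr _ _) (vmax g)).
have le3 : #|proper_colourings H| * (n./2 ^_ k * (n - n./2) ^_ k * (n./2 - k - u) ^ u) <=
  emb n./2.
  apply: embeddings_Kab_ge => //; first by clear; lia.
  by move=> chi; apply: colour_class_ge PP.
apply: leq_trans (max _ hh).
rewrite -(leq_pmul2l (isT : 0 < 2)); apply: leq_trans le2 _.
rewrite mulnCA; apply: leq_trans (leq_mul (leqnn 2) le3).
by rewrite [X in _ <= X]mulnCA leq_mul2l le1 orbT.
Qed.
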